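(* Let $N$ be a random variable with support $\mathcal{N}\subseteq\mathbb{N}$ such that $N>0$, and let $0=T_0\le\dots\le T_N=1$ be random points such that: (1) each $T_i$ takes values in a countable set $\mathcal{K}\subset[0,1]$; (2) for each $n\in\mathcal{N}$ and $(s_0,\dots,s_n)\in\mathcal{K}^{n+1}$ with $0=s_0\le\dots\le s_n=1$, the event $\{N=n,\ (T_0,\dots,T_n)=(s_0,\dots,s_n)\}$ is $\sigma(X_{s_i}:i=0,\dots,n)$-measurable. Then $$\mathbb{E}[F(X_1)\mathbf{1}_{\tau>1}]=\mathbb{E}\left[F(X_1)\prod_{i=0}^{N-1}\left(1-p(X_{T_i},X_{T_{i+1}},T_{i+1}-T_i)\right)\right]$$ for any measurable function $F$ with $\mathbb{E}[|F(X_1)|]<\infty$ and, furthermore, for every $t\in(0,1)$, $n\in\mathcal{N}$ and Borel set $A\subseteq\mathbb{R}$, $$\mathbb{P}\left[X_t\in A\mid N=n,T_0,\dots,T_N,X_{T_0},\dots,X_{T_N}\right]=\mathbb{P}^{\mathrm{BR}}_{(T_{i^*},\,T_{i^*+1},\,X_{T_{i^*}},\,X_{T_{i^*+1}})}\left[X_t\in A\right],$$ where $i^*=\max\{i:T_i\le t\}$.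
   Context: $X=(X_t)_{t\ge0}$ is a real-valued Lévy process (with $X_0=0$) with Lévy measure $\nu$. Standing assumptions: (1) $\nu$ has a continuously differentiable density $s:\mathbb{R}\setminus\{0\}\to(0,\infty)$ such that, for every $\varepsilon>0$, $\sup_{|x|\ge\varepsilon}s(x)<\infty$ and $\sup_{|x|\ge\varepsilon}|s'(x)|<\infty$; (2) for every $t>0$ the law of $X_t$ has a density $f_t$; (3) $f_t(x)>0$ for all $x\in\mathbb{R}$, $t>0$. $D=(a,b)$ with $a\in[-\infty,0)$, $b\in(0,\infty]$, and $\tau:=\inf\{t\ge0:X_t\notin D\}$. Bridge law: for $0\le s<t$ and $x,y\in\mathbb{R}$, $\mathbb{P}^{\mathrm{BR}}_{(s,t,x,y)}$ is the law of the bridge of $X$ on $[s,t]$ with starting value $x$ and terminal value $y$, i.e. a version of the regular conditional distribution of $\{x+X_{u-s}\}_{u\in[s,t]}$ given $X_{t-s}=y-x$ (uniquely defined for Lebesgue-a.e. $y$). Exit probability: $p(x,y,t):=\mathbb{P}^{\mathrm{BR}}_{(0,t,x,y)}[\tau\le t]=\mathbb{P}[\exists u\in[0,t]:x+X_u\notin(a,b)\mid X_t=y-x]$; for $t=0$ and $y=x$ this is read as $\mathbf{1}_{\{x\notin(a,b)\}}$. *)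

(* Defs.v *)
From HB Require Import structures.
From mathcomp Require Import all_boot all_order all_algebra.
From mathcomp Require Import lra.
From mathcomp Require Import all_classical all_reals all_analysis.
From mathcomp Require Import measurable_realfun.

Set Implicit Arguments.
Unset Strict Implicit.
Unset Printing Implicit Defensive.

Import Order.TTheory GRing.Theory Num.Theory.
Import numFieldNormedType.Exports.

Local Open Scope classical_set_scope.
Local Open Scope ring_scope.

(** * Levy processes *)

(* Time is represented by [R]; only times [0 <= t] are constrained. *)
Record levy_process d (T : measurableType d) (R : realType)
    (P : probability T R) := LevyProcess {
  process :> R -> T -> R ;
  levy_measurable : forall t : R, 0 <= t -> measurable_fun setT (process t) ;
  levy_start : forall w, process 0 w = 0 ;
  levy_rcont : forall w (u : R), 0 <= u ->
    process v w @[v --> u^'+] --> process u w ;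
  levy_llim : forall w (u : R), 0 < u -> cvg (process v w @[v --> u^'-]) ;
  levy_stationary : forall (s h : R) (B : set R),
    0 <= s -> 0 <= h -> measurable B ->
    P [set w | B (process (s + h) w - process s w)] =
    P [set w | B (process h w)] ;
  levy_independent : forall n (t : nat -> R) (B : nat -> set R), 0 <= t 0%N ->
    (forall i, (i < n)%N -> t i <= t i.+1) ->
    (forall i, measurable (B i)) ->
    P [set w | forall i, (i < n)%N ->
                 B i (process (t i.+1) w - process (t i) w)] =
    (\prod_(i < n)
       P [set w | B i (process (t i.+1) w - process (t i) w)%R])%E }.

Definition jump (R : realType) (w : R -> R) (u : R) : R :=
  w u - lim (w v @[v --> u^'-]).

(* Times in (0, 1] at which [w] has a nonzero jump with size in [A]. *)
Definition jump_times (R : realType) (w : R -> R) (A : set R) : set R :=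
  [set u | [/\ 0 < u <= 1, jump w u != 0 & A (jump w u)]].

(* [nu A] is the expected number of jumps with size in [A] per unit of time. *)
Definition is_levy_measure d (T : measurableType d) (R : realType)
    (P : probability T R) (X : levy_process P)
    (nu : {measure set R -> \bar R}) : Prop :=
  forall A : set R, measurable A ->
    nu A = (\int[P]_w counting (jump_times (X^~ w) A))%E.

(* The value of [s] at [0] is irrelevant. *)
Definition regular_levy_density (R : realType)
    (nu : {measure set R -> \bar R}) (s : R -> R) : Prop :=
  [/\ forall x : R, x != 0 -> 0 < s x,
      forall x : R, x != 0 ->
        derivable s x 1 /\ {for x, continuous (derive1 s)},
      forall e : R, 0 < e -> has_ubound [set s x | x in [set x | e <= `|x|]],
      forall e : R, 0 < e ->
        has_ubound [set `|derive1 s x| | x in [set x | e <= `|x|]] &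
      forall A : set R, measurable A ->
        nu A = (\int[lebesgue_measure]_(x in A `\ 0%R) (s x)%:E)%E].

Definition is_transition_density d (T : measurableType d) (R : realType)
    (P : probability T R) (X : levy_process P) (f : R -> R -> R) : Prop :=
  forall t : R, 0 < t -> measurable_fun setT (f t) /\
    forall A : set R, measurable A ->
      P [set w | A (X t w)] =
      (\int[lebesgue_measure]_(x in A) (f t x)%:E)%E.

(** * Path spaces *)

Definition clamp (R : realType) (s t u : R) : R := Num.max s (Num.min u t).

Lemma clampK (R : realType) (s t u : R) : clamp s t (clamp s t u) = clamp s t u.
Proof.
rewrite /clamp; have [h|h] := leP s (Num.min u t).
  have mt : Num.min u t <= t by rewrite ge_min lexx orbT.
  by rewrite (min_idPl mt) (max_idPr h).
by apply/max_idPl; rewrite ge_min lexx.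
Qed.

Lemma clampB (R : realType) (s t u : R) :
  clamp 0 (t - s) (u - s) = clamp s t u - s.
Proof. by rewrite /clamp addr_maxl addr_minl subrr. Qed.

(* Cadlag functions on [s, t].  They are represented by their extension to R
   that is constant on either side of [s, t], so that equality of functions on
   [s, t] is equality of representatives. *)
Record cadlag (R : realType) (s t : R) := Cadlag {
  path_fun :> R -> R ;
  path_rcont : forall u : R, s <= u < t ->
    path_fun v @[v --> u^'+] --> path_fun u ;
  path_llim : forall u : R, s < u <= t -> cvg (path_fun v @[v --> u^'-]) ;
  path_clamp : forall u, path_fun u = path_fun (clamp s t u) }.

Section cadlag_instances.
Context (R : realType) (s t : R).

Lemma cadlag_ext (w w' : cadlag s t) : path_fun w = path_fun w' -> w = w'.
Proof.
case: w => f a b c; case: w' => f' a' b' c' /= ff'.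
move: a b c a' b' c'; rewrite -ff' => a b c a' b' c'.
by rewrite (Prop_irrelevance a a') (Prop_irrelevance b b')
  (Prop_irrelevance c c').
Qed.

Lemma cst_rcont u : s <= u < t -> (cst 0 : R -> R) v @[v --> u^'+] --> (0 : R).
Proof. by move=> _; exact: cvg_cst. Qed.

Lemma cst_llim u : s < u <= t -> cvg ((cst 0 : R -> R) v @[v --> u^'-]).
Proof. by move=> _; exact: is_cvg_cst. Qed.

Definition cadlag0 : cadlag s t :=
  @Cadlag R s t (cst 0) cst_rcont cst_llim (fun=> erefl).

HB.instance Definition _ := gen_eqMixin (cadlag s t).
HB.instance Definition _ := gen_choiceMixin (cadlag s t).
HB.instance Definition _ := isPointed.Build (cadlag s t) cadlag0.

Definition cylinders : set_system (cadlag s t) :=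
  [set B | exists u, exists2 A : set R,
             measurable A & B = [set w | A (path_fun w u)]].

HB.instance Definition _ := @isMeasurable.Build (sigma_display cylinders)
  (cadlag s t) <<s cylinders >> (@sigma_algebra0 _ setT cylinders)
  (@sigma_algebraC (cadlag s t) cylinders)
  (@sigma_algebra_bigcup _ setT cylinders).

End cadlag_instances.

Section restriction.
Context d (T : measurableType d) (R : realType) (P : probability T R).
Variables (X : levy_process P) (t : R) (w : T).

Let f (u : R) : R := X (clamp 0 t u) w.

Let f_rcont u : 0 <= u < t -> f v @[v --> u^'+] --> f u.
Proof.
move=> /andP[u0 ut]; have -> : f u = X u w.
  by rewrite /f /clamp (min_idPl (ltW ut)) (max_idPr u0).
apply: (cvg_trans _ (@levy_rcont _ _ _ _ X w u u0)); apply: near_eq_cvg.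
near=> v; rewrite /f /clamp.
have uv : u < v by near: v; exact: nbhs_right_gt.
have vt : v < t by near: v; exact: nbhs_right_lt.
by rewrite (min_idPl (ltW vt)) (max_idPr (ltW (le_lt_trans u0 uv))).
Unshelve. all: by end_near. Qed.

Let f_llim u : 0 < u <= t -> cvg (f v @[v --> u^'-]).
Proof.
move=> /andP[u0 ut].
suff : f v @[v --> u^'-] --> lim (X v w @[v --> u^'-]) by move/cvgP.
apply: (cvg_trans _ (@levy_llim _ _ _ _ X w u u0)); apply: near_eq_cvg.
near=> v; rewrite /f /clamp.
have v0 : 0 < v by near: v; exact: nbhs_left_gt.
have vu : v < u by near: v; exact: nbhs_left_lt.
by rewrite (min_idPl (ltW (lt_le_trans vu ut))) (max_idPr (ltW v0)).
Unshelve. all: by end_near. Qed.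

Let f_clamp u : f u = f (clamp 0 t u).
Proof. by rewrite /f clampK. Qed.

(* The path (X_u)_{u in [0, t]}. *)
Definition levy_path : cadlag 0 t := Cadlag f_rcont f_llim f_clamp.

End restriction.

Section shift.
Context (R : realType) (s t x : R).
Variable w : cadlag 0 (t - s).

Let f (u : R) : R := x + w (u - s).

Let f_rcont u : s <= u < t -> f v @[v --> u^'+] --> f u.
Proof.
move=> su; rewrite /f; apply: cvgD; first exact: cvg_cst.
have {}su : 0 <= u - s < t - s by lra.
apply: (cvg_trans _ (@path_rcont _ _ _ w (u - s) su)) => A /=.
rewrite /nbhs /= /at_right /within /= => -[e e0 eA].
exists e => //= v /= uv ltv; apply: (eA (v - s)) => /=; last by lra.
by rewrite opprB addrA subrK.
Qed.

Let f_llim u : s < u <= t -> cvg (f v @[v --> u^'-]).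
Proof.
move=> su; rewrite /f; apply: is_cvgD; first exact: is_cvg_cst.
have {}su : 0 < u - s <= t - s by lra.
suff : w (v - s) @[v --> u^'-] --> lim (w v @[v --> (u - s)^'-]) by move/cvgP.
apply: (cvg_trans _ (@path_llim _ _ _ w (u - s) su)) => A /=.
rewrite /nbhs /= /at_left /within /= => -[e e0 eA].
exists e => //= v /= uv ltv; apply: (eA (v - s)) => /=; last by lra.
by rewrite opprB addrA subrK.
Qed.

Let f_clamp u : f u = f (clamp s t u).
Proof. by rewrite /f path_clamp clampB. Qed.

(* The path (x + w_{u - s})_{u in [s, t]}. *)
Definition shift_path : cadlag s t := Cadlag f_rcont f_llim f_clamp.

End shift.

Lemma measurable_shift_path (R : realType) (s t x : R) :
  measurable_fun setT (@shift_path R s t x).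
Proof.
apply: (@measurability _ _ _ _ setT _ (@cylinders R s t)) => //.
move=> _ [_ [u [A mA ->]] <-]; rewrite setTI.
apply: sub_sigma_algebra; exists (u - s).
exists [set r | A (x + r)] => //.
have mx : measurable_fun setT (fun r : R => x + r).
  exact: measurable_funD.
by rewrite -[X in measurable X]setTI; exact: mx.
Qed.

(** * Bridges *)

(* [k] is a version of the regular conditional distribution of
   (X_u)_{u in [0, t]} given X_t, as a law on cadlag paths. *)
Definition is_bridge_kernel d (T : measurableType d) (R : realType)
    (P : probability T R) (X : levy_process P) (t : R)
    (k : R.-pker R ~> cadlag 0 t) : Prop :=
  forall (A : set R) (B : set (cadlag 0 t)), measurable A -> measurable B ->
    P [set w | A (X t w) /\ B (levy_path X t w)] =
    (\int[P]_(w in [set w | A (X t w)]) k (X t w) B)%E.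

(* Law of the bridge on [s, t] from [x] to [y], for [s < t].  The family [k] is
   a choice of one version of the conditional law for each duration; it is
   evaluated at the increment [y - x]. *)
Definition bridge_law (R : realType)
    (k : forall t : R, R.-pker R ~> cadlag 0 t) (s t x y : R) :
    set (cadlag s t) -> \bar R :=
  pushforward (k (t - s) (y - x)) (@shift_path R s t x).

Arguments bridge_law {R} k s t x y _.

(** * Exit from D = (a, b) *)

Definition domain (R : realType) (a b : \bar R) : set R :=
  [set x | (a < x%:E)%E /\ (x%:E < b)%E].

Definition exit_time (R : realType) (a b : \bar R) (I : set R) (w : R -> R) :
    \bar R :=
  ereal_inf [set u%:E | u in [set u | I u /\ ~ domain a b (w u)]].

(* The exit event is the projection of a measurable set; in general it lies in
   the completion of the sigma-algebra of the path space but not in the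
   sigma-algebra itself (a path may touch the boundary of D from the left
   without leaving D).  Its probability is therefore the value of the completed
   measure, i.e. of the outer measure [mu^*].  The library's integral of a
   function measurable for the completion only is the integral against the
   completed measure, so that ['E_P] can be used without further ado. *)
Definition exit_prob (R : realType) (a b : \bar R)
    (k : forall t : R, R.-pker R ~> cadlag 0 t) (x y t : R) : R :=
  if t == 0 then \1_(~` domain a b) x
  else fine ((bridge_law k 0 t x y)^*%mu
               [set w | (exit_time a b `[0%R, t] w <= t%:E)%E]).

(** * Sigma-algebras and conditional probabilities *)

Definition sigma_generated d d' (T : measurableType d) (U : measurableType d')
    (n : nat) (Y : nat -> T -> U) : set_system T :=
  <<s [set B | exists2 i, (i <= n)%N &
         exists2 A : set U, measurable A & B = Y i @^-1` A] >>.

(* [Y] is a version on [C] of the conditional probability of [E] given [G] under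
   P( . | C ): both sides of the defining identity are multiplied by [P C], and
   as only [C] is charged, [Y] and [G] matter only through their traces on
   [C]. *)
Definition is_cond_prob d (T : measurableType d) (R : realType)
    (P : probability T R) (C : set T) (G : set_system T) (E : set T)
    (Y : T -> \bar R) : Prop :=
  (forall S : set (\bar R), measurable S ->
     exists2 B, G B & C `&` Y @^-1` S = C `&` B) /\
  (forall B, G B -> (\int[P]_(w in C `&` B) Y w)%E = P (E `&` (C `&` B))).

(* The (discrete) support of [N]. *)
Definition nat_support d (T : measurableType d) (R : realType)
    (P : probability T R) (N : T -> nat) : set nat :=
  [set n | (0 < P (N @^-1` [set n]))%E].

Definition last_before (R : realType) (n : nat) (T : nat -> R) (t : R) : nat :=
  \max_(i < n.+1 | T i <= t) i.

(* Main.v *)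
Require Import Defs.
From HB Require Import structures.
From mathcomp Require Import all_boot all_order all_algebra.
From mathcomp Require Import all_classical all_reals all_analysis.
From mathcomp Require Import measurable_realfun.
From mathcomp Require Import lra ring.

Import Order.TTheory GRing.Theory Num.Theory.
Import numFieldNormedType.Exports.

Local Open Scope classical_set_scope.
Local Open Scope ring_scope.

Set Implicit Arguments.
Unset Strict Implicit.
Unset Printing Implicit Defensive.

(* On a fixed grid r_0 <= ... <= r_n, the path of X over [r_j, r_j+1] started at
   r_j is independent of the past and of the increments after r_j+1; freezing
   everything but this segment (Fubini) and disintegrating its law along its
   endpoint replaces any event of the segment by its bridge probability, against
   every factor measurable with respect to the values of X outside (r_j, r_j+1).
   Doing this for one segment after the other, on each of the countably many
   events {N = n, T = r}, which are observable at the times of r, gives both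
   claims.

   The exit event of a segment is only a Suslin set of paths. A capacity argument
   encloses it between two measurable sets whose difference is null for the law of
   the segment, and both sides of the identity are squeezed between the integrals
   obtained from the inner and from the outer sets. *)

(** * Suslin sets are sandwiched between measurable sets *)

(** Rational times do not decide the exit event: a right-continuous path may meet the closed
    complement of the domain at a single time, with all nearby values inside. Hence the detour
    through Suslin's operation. The outer measure in [exit_prob] is taken under each bridge law
    separately, whereas the gap between the two enclosing sets is null only under the unconditional
    law of the segment; for a particular pair of endpoints the two bounds may differ. The exit
    probability is therefore never identified with a measurable function of the endpoints: it is
    bounded pointwise by two such functions, and the bounds are compared only after integration.
    Consecutive times may coincide, while bridges are given for positive durations. A segment of
    length zero carries, on both sides of the identity, the indicator that its single position lies
    in the domain. *)

Definition update (T : Type) (h : nat -> T) (k : nat) (j : T) (i : nat) : T :=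
  if i == k then j else h i.

(** Since [Q k] reads only the first [k] entries and later stages never revise a decided entry, the
    diagonal of the stages satisfies every [Q k]. This produces binary expansions, the branch in
    König's lemma and the thresholds of the capacity argument. *)
Lemma dependent_sequence (T : Type) (Q : nat -> (nat -> T) -> Prop) (h0 : nat -> T) :
  (forall k h h', (forall i, (i < k)%N -> h i = h' i) -> Q k h -> Q k h') ->
  Q 0%N h0 ->
  (forall k h, Q k h -> exists j, Q k.+1 (update h k j)) ->
  exists h, forall k, Q k h.
Proof.
move=> ext Q0 step.
have [F FP] : exists F : nat -> (nat -> T) -> T,
    forall k h, Q k h -> Q k.+1 (update h k (F k h)).
  have H (kh : nat * (nat -> T)) :
      exists j, Q kh.1 kh.2 -> Q kh.1.+1 (update kh.2 kh.1 j).
    have [/step[j Qj]|nQ] := pselect (Q kh.1 kh.2); first by exists j.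
    by exists (h0 0%N) => /nQ.
  have [F FP] := choice H.
  by exists (fun k h => F (k, h)) => k h; exact: (FP (k, h)).
pose H := fix H k := if k is k'.+1 then update (H k') k' (F k' (H k')) else h0.
have QH k : Q k (H k) by elim: k => //= k; exact: FP.
have stab k i j : (i < k)%N -> H (k + j)%N i = H k i.
  move=> ik; elim: j => [|j IH]; first by rewrite addn0.
  rewrite addnS /= /update ifF ?IH//; apply/negbTE.
  by rewrite neq_ltn (leq_trans ik) ?leq_addr.
exists (fun n => H n.+1 n) => k; apply: ext (QH k) => i ik.
by rewrite -(subnKC ik) stab.
Qed.

Section outer.
Context d (T : measurableType d) (R : realType) (mu : probability T R).
Local Open Scope ereal_scope.

(** Single measurable supersets take the place of countable covers, so that a measurable hull is
    just the intersection of a minimising sequence. *)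
Definition outer (A : set T) : \bar R :=
  ereal_inf [set mu B | B in [set B | measurable B /\ A `<=` B]].

Lemma outer_le A B : measurable B -> A `<=` B -> outer A <= mu B.
Proof. by move=> mB AB; apply: ereal_inf_lbound; exists B. Qed.

Lemma outer_hull A : exists U, [/\ measurable U, A `<=` U & mu U = outer A].
Proof.
have fin : outer A \is a fin_num.
  rewrite ge0_fin_numE.
    by rewrite (le_lt_trans (@outer_le A setT _ _))// probability_setT ltry.
  by apply: le_ereal_inf_tmp => _ [B _ <-].
have H (n : nat) : exists B, [/\ measurable B, A `<=` B &
    mu B < outer A + n.+1%:R^-1%:E].
  have : exists2 x, [set mu B | B in [set B | measurable B /\ A `<=` B]] x &
    x < outer A + n.+1%:R^-1%:E by apply: lb_ereal_inf_adherent.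
  by move=> [_ [B [mB AB] <-]] h; exists B.
have {H}[U UP] := choice H.
exists (\bigcap_n U n); have mU : measurable (\bigcap_n U n).
  by apply: bigcapT_measurable => n; have [] := UP n.
have AU : A `<=` \bigcap_n U n by move=> x Ax n _; have [_ + _] := UP n; exact.
split => //; apply/eqP; rewrite eq_le outer_le// andbT.
apply/lee_addgt0Pr => e e0.
have [n ne] : exists n : nat, (n.+1%:R^-1 < e)%R.
  have [N _ hN] := near_infty_natSinv_lt (PosNum e0).
  by exists N; exact: (hN N (leqnn N)).
have [mUn _ lt] := UP n.
apply: (@le_trans _ _ (mu (U n))).
  by apply: le_measure; rewrite ?inE// => x; apply.
by rewrite (le_trans (ltW lt))// leeD2l// lee_fin ltW.
Qed.

Lemma le_outer A B : A `<=` B -> outer A <= outer B.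
Proof.
by move=> AB; have [U [mU BU <-]] := outer_hull B; rewrite outer_le// => x /AB/BU.
Qed.

(** Hulls of the pieces need not increase, but the intersections [V n] of their tails do; they still
    contain [A n] and are no larger than its hull. This continuity from below on arbitrary sets
    makes the outer measure a capacity. *)
Lemma outer_bigcup (A : nat -> set T) (c : \bar R) :
  nondecreasing_seq A -> c < outer (\bigcup_n A n) -> exists n, c < outer (A n).
Proof.
move=> ndA cA; apply: contrapT => /forallNP nc.
have le n : outer (A n) <= c by rewrite leNgt; apply/negP/nc.
move: cA; apply/negP; rewrite -leNgt.
have [U UP] := choice (fun n => outer_hull (A n)).
pose V n := \bigcap_(i in [set i | (n <= i)%N]) U i.
have mV n : measurable (V n) by apply: bigcap_measurable => [|i _];
  [exists n => /= | have [] := UP i].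
have AV n : A n `<=` V n.
  move=> x Ax i /= ni; have [_ + _] := UP i; apply.
  by move/ndA: ni => /subsetPset; apply.
have ndV : nondecreasing_seq V.
  move=> m n mn; apply/subsetPset => x Vx i /= ni; apply: Vx => /=.
  exact: leq_trans ni.
have mbV : measurable (\bigcup_n V n) by apply: bigcupT_measurable.
apply: (@le_trans _ _ (mu (\bigcup_n V n))).
  by apply: outer_le => // x [n _ /AV Vx]; exists n.
have cv := @nondecreasing_cvg_mu _ _ _ mu _ mV mbV ndV.
rewrite -(cvg_lim _ cv)//; apply: lime_le; first by apply/cvg_ex; eexists; exact: cv.
apply: nearW => n /=; apply: le_trans (le n).
have [mUn _ <-] := UP n; apply: le_measure; rewrite ?inE//.
by move=> x; apply => /=.
Qed.

End outer.

Section suslin.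
Context d (T : measurableType d) (R : realType) (mu : probability T R).
Variable G : nat -> nat -> (nat -> bool) -> set T.
Hypothesis mG : forall n m e, measurable (G n m e).
Hypothesis G_prefix : forall n m e e', (forall i, (i < m)%N -> e i = e' i) ->
  G n m e = G n m e'.

(** Along some binary branch [e], every precision [n] is met from some depth on. Collecting these
    depths in a sequence [h] shows [E] as a union over pairs [(e, h)]. Compactness deals with [e],
    the capacity property with [h]. *)
Let E := [set w | exists e, forall n, exists h, forall m, (h <= m)%N -> G n m e w].

(** The first [k] thresholds are prescribed, the others still free. As the threshold of index [k]
    grows, the sets with one more prescription increase to this one, so continuity from below fixes
    the thresholds one at a time. *)
Let Eh k (h : nat -> nat) := [set w | exists2 e,
  forall n, (n < k)%N -> forall m, (h n <= m)%N -> G n m e w &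
  forall n, exists h, forall m, (h <= m)%N -> G n m e w].

Let P (h : nat -> nat) w K e :=
  forall n m, (n < K)%N -> (h n <= m < K)%N -> G n m e w.

Let Ch h K := [set w | exists e, P h w K e].

(** Conditions of depth below [K] read at most [K] digits, so the union over branches is a finite
    one. *)
Let mCh h K : measurable (Ch h K).
Proof.
pose ext (t : K.-tuple bool) i := nth false t i.
have -> : Ch h K = \bigcup_(t in [set: K.-tuple bool])
    \bigcap_n \bigcap_m
      (if ((n < K) && (h n <= m < K))%N then G n m (ext t) else setT).
  apply/seteqP; split => [w [e Pe]|w [t _ Pt]].
    exists [tuple e i | i < K] => // n _ m _; case: ifPn => // /andP[nK hm].
    rewrite (@G_prefix _ _ _ e); first exact: Pe.
    move=> i im; have iK : (i < K)%N by case/andP: hm => _; exact: ltn_trans.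
    by rewrite /ext (nth_map (Ordinal iK)) ?size_enum_ord//= nth_enum_ord.
  exists (ext t) => n m nK hm.
  by have := Pt n I m I; rewrite nK hm.
apply: fin_bigcup_measurable => [|t _]; first exact: finite_finset.
by apply: bigcapT_measurable => n; apply: bigcapT_measurable => m; case: ifP.
Qed.

(** König's lemma: a prefix with witnesses to every depth has an extension by one digit with the
    same property. Were both digits to fail, at depths [K1] and [K2], a witness to the larger depth
    would contradict one of the failures. *)
Let konig h : \bigcap_K Ch h K `<=` E.
Proof.
move=> w Cw.
have dec K K' e : (K <= K')%N -> P h w K' e -> P h w K e.
  move=> KK Pe n m nK /andP[hm mK]; apply: Pe; first exact: leq_trans KK.
  by rewrite hm (leq_trans mK).
have [e eP] : exists e, forall k, forall K, exists2 e',
    (forall i, (i < k)%N -> e i = e' i) & P h w K e'.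
  apply: (@dependent_sequence _ _ xpred0).
  - move=> k e1 e2 e12 + K => /(_ K)[e' ee' Pe']; exists e' => // i ik.
    by rewrite -e12// ee'.
  - by move=> K; have [e' Pe'] := Cw K I; exists e'.
  - move=> k e He; apply: contrapT => /forallNP H.
    have := H true; have := H false.
    move=> /existsNP[K1 /forall2NP N1] /existsNP[K2 /forall2NP N2].
    have [e' ee' Pe'] := He (maxn K1 K2).
    have aux b : e' k = b -> forall i, (i < k.+1)%N -> update e k b i = e' i.
      move=> ek i; rewrite ltnS /update leq_eqVlt; case: eqVneq => [->//|_ /=].
      exact: ee'.
    case ek : (e' k).
    + case: (N2 e') => //; last by apply; apply: dec Pe'; exact: leq_maxr.
      by apply; apply: aux.
    + case: (N1 e') => //; last by apply; apply: dec Pe'; exact: leq_maxl.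
      by apply; apply: aux.
exists e => n; exists (h n) => m hm.
have [e' ee' Pe'] := eP m (maxn n.+1 m.+1).
rewrite (@G_prefix _ _ _ e'); last by move=> i im; rewrite ee'.
by apply: Pe'; rewrite ?hm leq_max ltnSn ?orbT.
Qed.

Local Open Scope ereal_scope.

(** The thresholds are chosen so that the outer measure of [Eh k h] stays above [c]. The measurable
    sets [Ch h K] contain [Eh K h] and decrease to a subset of [E], which therefore has measure at
    least [c]. *)
Let inner c : c < outer mu E -> exists L, [/\ measurable L, L `<=` E & c <= mu L].
Proof.
move=> cE.
have [h hP] : exists h, forall k, c < outer mu (Eh k h).
  apply: (@dependent_sequence _ _ (fun=> 0%N)).
  - move=> k h h' hh' /lt_le_trans; apply; apply: le_outer => w [e e1 e2].
    by exists e => // n nk m; rewrite -hh'//; exact: e1.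
  - apply: lt_le_trans cE _; apply: le_outer => w [e He].
    by exists e.
  - move=> k h cEh; apply: outer_bigcup.
      move=> j j' jj'; apply/subsetPset => w [e e1 e2]; exists e => // n nk m.
      move=> hm; apply: e1 => //; apply: leq_trans hm.
      by rewrite /update; case: ifP.
    apply: lt_le_trans cEh _; apply: le_outer => w [e e1 e2].
    have [j hj] := e2 k; exists j => //; exists e => // n; rewrite ltnS /update.
    rewrite leq_eqVlt; case: eqVneq => [->//|_ /= nk m]; exact: e1.
exists (\bigcap_K Ch h K); split => //; first exact: bigcapT_measurable.
have ndC : nonincreasing_seq (Ch h).
  move=> K K' KK; apply/subsetPset => w [e Pe]; exists e => n m nK /andP[hm mK].
  by apply: Pe; rewrite ?(leq_trans nK)// hm (leq_trans mK).
have cv := @nonincreasing_cvg_mu _ _ _ mu _ (le_lt_trans (probability_le1 mu (mCh h 0)) (ltry 1)) (mCh h)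
  (bigcapT_measurable (mCh h)) ndC.
rewrite -(cvg_lim _ cv)//; apply: lime_ge; first by apply/cvg_ex; eexists; exact: cv.
apply: nearW => K /=; apply: (le_trans (ltW (hP K))); apply: outer_le => //.
by move=> w [e e1 e2]; exists e => n m nK /andP[hm _]; exact: e1.
Qed.

(* Choquet's capacitability argument: [E] is the result of Suslin's operation
   on measurable sets, and its outer measure is attained from inside. *)
Lemma suslin_sandwich : exists L U, [/\ measurable L, measurable U, L `<=` E,
  E `<=` U & mu (U `\` L) = 0].
Proof.
have [U [mU EU Uo]] := outer_hull mu E.
have Ufin : mu U \is a fin_num by exact: fin_num_measure.
have H (n : nat) : exists L, [/\ measurable L, L `<=` E & mu U - n.+1%:R^-1%:E <= mu L].
  by apply: inner; rewrite -Uo lteBlDr// lteDl// lte_fin.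
have {H}[L LP] := choice H; exists (\bigcup_n L n), U.
have mL : measurable (\bigcup_n L n).
  by apply: bigcupT_measurable => n; have [] := LP n.
have LE : \bigcup_n L n `<=` E by move=> w [n _]; have [_ + _] := LP n; exact.
split => //.
rewrite measureD//; last by rewrite ltey_eq Ufin.
rewrite setIidr; last exact: subset_trans EU.
apply/eqP; rewrite sube_eq // ?fin_num_measure//.
rewrite add0e eq_le; apply/andP; split; last first.
  by apply: le_measure; rewrite ?inE//; exact: subset_trans EU.
apply/lee_addgt0Pr => e e0.
have [n ne] : exists n : nat, (n.+1%:R^-1 < e)%R.
  have [N _ hN] := near_infty_natSinv_lt (PosNum e0).
  by exists N; exact: (hN N (leqnn N)).
have [mLn _] := LP n; rewrite leeBlDr// => /le_trans; apply; apply: leeD.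
  by apply: le_measure; rewrite ?inE//; exact: bigcup_sup.
by rewrite lee_fin ltW.
Qed.

End suslin.

(** * Hitting of closed sets by right-continuous paths *)

Section dyadic.
Context (R : realType).
Implicit Types (e : nat -> bool) (u : R).

Definition dyadic_sum e m : R := \sum_(i < m) (e i)%:R * 2^-1 ^+ i.+1.

(** The right end of the dyadic interval of rank [m]: a time has to be approached from the right for
    right-continuity to apply. *)
Definition dyadic_ceil e m : R := dyadic_sum e m + 2^-1 ^+ m.

Lemma dyadic_sumS e m : dyadic_sum e m.+1 = dyadic_sum e m + (e m)%:R * 2^-1 ^+ m.+1.
Proof. by rewrite /dyadic_sum big_ord_recr. Qed.

Lemma dyadic_expansion u : 0 <= u <= 1 -> exists e, forall m,
  dyadic_sum e m <= u <= dyadic_ceil e m.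
Proof.
move=> u01; apply: (@dependent_sequence _ _ xpred0).
- move=> k e e' ee'; rewrite /dyadic_ceil.
  suff -> : dyadic_sum e k = dyadic_sum e' k by [].
  by apply: eq_bigr => i _; rewrite ee'.
- by rewrite /dyadic_ceil /dyadic_sum big_ord0 expr0 add0r.
- move=> k e; rewrite /dyadic_ceil => /andP[h1 h2].
  have su b : dyadic_sum (update e k b) k = dyadic_sum e k.
    by apply: eq_bigr => i _; rewrite /update ltn_eqF.
  exists (dyadic_sum e k + 2^-1 ^+ k.+1 <= u).
  rewrite dyadic_sumS su /update eqxx.
  have h : (2^-1 : R) ^+ k = 2^-1 ^+ k.+1 + 2^-1 ^+ k.+1 by rewrite exprS; field.
  move: h1 h2; rewrite h; set x := 2^-1 ^+ k.+1; set y := dyadic_sum e k.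
  by case: (leP (y + x) u) => hh h1 h2; apply/andP; rewrite /= ?mulr1n ?mulr0n; split; lra.
Qed.

Lemma dyadic_ceil_noninc e : nonincreasing_seq (dyadic_ceil e).
Proof.
apply/nonincreasing_seqP => m; rewrite /dyadic_ceil dyadic_sumS.
have x0 : 0 <= (2^-1 : R) ^+ m.+1 by rewrite exprn_ge0.
have h : (2^-1 : R) ^+ m = 2^-1 ^+ m.+1 + 2^-1 ^+ m.+1 by rewrite exprS; field.
rewrite h; move: x0; set x := 2^-1 ^+ m.+1; set y := dyadic_sum e m.
by case: (e m) => x0; rewrite /= ?mul1r ?mul0r; lra.
Qed.

Lemma dyadic_sum_ge0 e m : 0 <= dyadic_sum e m.
Proof. by apply: sumr_ge0 => i _; rewrite mulr_ge0// exprn_ge0. Qed.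

Lemma dyadic_ceil_ge0 e m : 0 <= dyadic_ceil e m.
Proof. by rewrite addr_ge0 ?dyadic_sum_ge0// exprn_ge0. Qed.

Lemma dyadic_ceil_le1 e m : dyadic_ceil e m <= 1.
Proof.
apply: (le_trans (dyadic_ceil_noninc _ (leq0n m))).
by rewrite /dyadic_ceil /dyadic_sum big_ord0 add0r expr0.
Qed.

Lemma cvg_dyadic_ceil e u : (forall m, dyadic_sum e m <= u <= dyadic_ceil e m) ->
  dyadic_ceil e m @[m --> \oo] --> u.
Proof.
move=> eu; apply: (@squeeze_cvgr _ _ _ _ (fun=> u) (fun m => u + 2^-1 ^+ m)).
- apply: nearW => m; have /andP[h1 ->] := eu m.
  by rewrite /dyadic_ceil lerD2r.
- exact: cvg_cst.
- rewrite -[X in _ --> X]addr0; apply: cvgD; first exact: cvg_cst.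
  by apply: cvg_expr; rewrite ger0_norm ?invr_ge0// invf_lt1 ?ltr1n.
Qed.

End dyadic.

Section hitting.
Context d (T : measurableType d) (R : realType) (mu : probability T R).

Let nearF (F : set R) (n : nat) :=
  [set y | exists2 z, F z & `|y - z| < n.+1%:R^-1].

Let open_nearF F n : open (nearF F n).
Proof.
have -> : nearF F n = \bigcup_(z in F) ball z (n.+1%:R^-1).
  by apply/seteqP; split => [y [z Fz yz]|y [z Fz yz]]; exists z => //;
    move: yz; rewrite /ball /= distrC.
by apply: bigcup_open => z _; apply: ball_open.
Qed.

(** Membership of a limit is translated into countably many eventual conditions on the approximating
    values; openness of [nearF F n] gives one direction, closedness of [F] the other. *)
Let nearF_cvg (F : set R) (y_ : nat -> R) (y : R) : closed F ->
  y_ m @[m --> \oo] --> y ->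
  F y <-> forall n, exists h, forall m, (h <= m)%N -> nearF F n (y_ m).
Proof.
move=> cF yy; split=> [Fy n|H].
  have /yy [h _ hP] : nbhs y (nearF F n).
    by apply: open_nbhs_nbhs; split => //; exists y => //; rewrite subrr normr0.
  by exists h => m /hP.
apply: contrapT => nFy.
have : nbhs y (~` F) by apply: open_nbhs_nbhs; split => //; exact: closed_openC.
move=> /nbhs_ballP[r /= r0 rF].
have r20 : 0 < r / 2 by rewrite divr_gt0.
have [n ne] : exists n : nat, (n.+1%:R^-1 < r / 2).
  have [N _ hN] := near_infty_natSinv_lt (PosNum r20).
  by exists N; exact: (hN N (leqnn N)).
have [h hP] := H n.
have /yy [h' _ h'P] : nbhs y (ball y (r / 2)) by exact: nbhsx_ballx.
have [z Fz zy] := hP (maxn h h') (leq_maxl _ _).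
have /= := h'P (maxn h h') (leq_maxr _ _); rewrite /ball /= => yb.
apply: (rF z) => //; rewrite /ball /=.
by rewrite (le_lt_trans (ler_distD (y_ (maxn h h')) _ _))//; rewrite [ltRHS]splitr ltrD // (lt_trans zy).
Qed.

(* Times are coded by binary digits: unlike [0, t], Cantor space makes every
   condition on finitely many grid values of the path open and closed. *)
Lemma hitting_sandwich (F : set R) (t : R) (Y : R -> T -> R) : closed F -> 0 <= t ->
  (forall u, 0 <= u <= t -> measurable_fun setT (Y u)) ->
  (forall w u, 0 <= u < t -> Y v w @[v --> u^'+] --> Y u w) ->
  let E := [set w | exists2 u, 0 <= u <= t & F (Y u w)] in
  exists L U, [/\ measurable L, measurable U, L `<=` E, E `<=` U &
    mu (U `\` L) = 0%E].
Proof.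
move=> cF t0 mY rY E.
pose G n m e := Y (t * dyadic_ceil R e m) @^-1` nearF F n.
have tq e m : 0 <= t * dyadic_ceil R e m <= t.
  by rewrite mulr_ge0 ?dyadic_ceil_ge0//= ler_piMr ?dyadic_ceil_le1.
have [] := @suslin_sandwich _ _ _ mu G.
- move=> n m e; rewrite -[X in measurable X]setTI; apply: mY => //.
  by apply: open_measurable; exact: open_nearF.
- move=> n m e e' ee'; rewrite /G /dyadic_ceil.
  suff -> : dyadic_sum R e m = dyadic_sum R e' m by [].
  by apply: eq_bigr => i _; rewrite ee'.
have key w e u : 0 <= u <= 1 -> (forall m, dyadic_sum R e m <= u <= dyadic_ceil R e m) ->
    F (Y (t * u) w) <-> forall n, exists h, forall m, (h <= m)%N -> G n m e w.
  move=> u01 eu; apply: nearF_cvg => //.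
  have tu : 0 <= t * u by rewrite mulr_ge0//; case/andP: u01.
  have ge m : t * u <= t * dyadic_ceil R e m by rewrite ler_wpM2l//; case/andP: (eu m).
  (* Right-continuity is given before [t] only. When the limit time is [t] itself, the grid times
     lie between it and [t] and are constant. *)
  have [tut|tut] := ltP (t * u) t; last first.
    have -> : (fun m => Y (t * dyadic_ceil R e m) w) = cst (Y (t * u) w).
      apply/funext => m; congr (Y _ w); apply/eqP; rewrite eq_le ge andbT.
      by rewrite (le_trans _ tut)//; case/andP: (tq e m).
    exact: cvg_cst.
  have cq : t * dyadic_ceil R e m @[m --> \oo] --> t * u.
    by apply: cvgM; [exact: cvg_cst|exact: cvg_dyadic_ceil].
  have r := rY w (t * u) (introT andP (conj tu tut)).
  (* A grid time may equal the limit time, which the punctured right neighbourhood omits; [Y0]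
     covers this case. *)
  move=> A AY; have Y0 := nbhs_singleton AY.
  have {r} := r _ AY; rewrite /nbhs /= /at_right /within /= => Ar.
  have [h _ hP] := cq _ Ar; exists h => // m /hP /= H.
  have := ge m; rewrite le_eqVlt => /predU1P[<-//|]; exact: H.
move=> L [U [mL mU LE EU UL]]; exists L, U; split => //.
(* Every branch codes a time, the limit of its decreasing right ends, so the Suslin set contains
   nothing but points that hit [F]. *)
- move=> w /LE[e He].
  have cv : cvgn (dyadic_ceil R e).
    apply: nonincreasing_is_cvgn; first exact: dyadic_ceil_noninc.
    by exists 0 => _ [m _ <-]; exact: dyadic_ceil_ge0.
  pose u := limn (dyadic_ceil R e).
  have lq m : u <= dyadic_ceil R e m.
    by apply: nonincreasing_cvgn_ge => //; exact: dyadic_ceil_noninc.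
  have u01 : 0 <= u <= 1.
    apply/andP; split; last exact: le_trans (lq 0%N) (dyadic_ceil_le1 _ _ _).
    by apply: limr_ge => //; apply: nearW => m; exact: dyadic_ceil_ge0.
  have su m : dyadic_sum R e m <= u.
    apply: limr_ge => //; exists m => // m' /= mm'.
    rewrite /dyadic_ceil ler_wpDr ?exprn_ge0// -(subnKC mm') /dyadic_sum.
    by rewrite big_split_ord /= lerDl sumr_ge0// => i _; rewrite mulr_ge0// exprn_ge0.
  exists (t * u); last by apply/(key w e u u01) => // m; rewrite su lq.
  by rewrite mulr_ge0//= ?ler_piMr//; case/andP: u01.
- move=> w [v /andP[v0 vt] FY]; apply: EU.
  have [u u01 tuv] : exists2 u, 0 <= u <= 1 & v = t * u.
    have [t0'|t0'] := eqVneq t 0.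
      by exists 0; rewrite ?lexx ?ler01// mulr0; lra.
    have tp : 0 < t by rewrite lt_def t0'.
    exists (v / t); last by rewrite mulrC divfK.
    by rewrite divr_ge0//= ler_pdivrMr// mul1r.
  have [e eu] := dyadic_expansion u01.
  by exists e; apply/(key w e u) => //; rewrite -tuv.
Qed.

End hitting.

(** * Cylinder sigma-algebras *)

Section cylinders.
Context (T : pointedType) (R : realType) (I : Type).

Definition cyl (f : I -> T -> R) (J : set I) : set_system T :=
  [set B | exists2 i, J i & exists2 A : set R, measurable A & B = f i @^-1` A].

(** The same points with the coarser sigma-algebra of the coordinates in [J]: being observable at
    these coordinates becomes ordinary measurability on this type. *)
Definition gcyl f J := g_sigma_algebraType (cyl f J).

Lemma measurable_coord f J i : J i -> measurable_fun setT (f i : gcyl f J -> R).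
Proof.
move=> Ji _ A mA; rewrite setTI; apply: sub_sigma_algebra.
by exists i => //; exists A.
Qed.

Lemma measurable_gcyl d' (T' : measurableType d') f J (h : T' -> gcyl f J) :
  (forall i, J i -> measurable_fun setT (fun w => f i (h w))) ->
  measurable_fun setT h.
Proof.
move=> mh; have := (@measurability _ _ T' (gcyl f J) setT h (cyl f J)); apply => //.
by move=> _ [_ [i Ji [B mB ->]] <-]; exact: mh.
Qed.

(** Indices may repeat and come in any order, so that concatenation makes rectangles stable under
    intersection. *)
Definition rect (f : I -> T -> R) n (t : nat -> I) (A : nat -> set R) : set T :=
  [set w | forall j, (j < n)%N -> A j (f (t j) w)].

Lemma rect_bigcap f n t A :
  rect f n t A = \bigcap_(j in [set j | (j < n)%N]) (f (t j) @^-1` A j).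
Proof. by []. Qed.

Lemma measurable_rect f J n t A : (forall j, (j < n)%N -> J (t j)) ->
  (forall j, measurable (A j)) -> measurable (rect f n t A : set (gcyl f J)).
Proof.
move=> Jt mA; rewrite rect_bigcap; have [->|n0] := posnP n.
  by rewrite (_ : \bigcap_(j in _) _ = setT)//; apply/seteqP; split.
apply: bigcap_measurable => [|j /= jn]; first by exists 0%N.
rewrite -[X in measurable X]setTI; apply: measurable_coord => //.
exact: Jt.
Qed.

End cylinders.

Section cylinder_unique.
Context d (T : measurableType d) (R : realType).

Definition cyl_fun (I : Type) (f : I -> T -> R) (J : set I) : Prop :=
  forall i, J i -> measurable_fun setT (f i).

Lemma gcyl_measurable I (f : I -> T -> R) (J : set I) (B : set T) : cyl_fun f J ->
  (measurable (B : set (gcyl f J))) -> measurable B.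
Proof.
move=> mf; apply: smallest_sub; first exact: sigma_algebra_measurable.
by move=> _ [i Ji [A mA ->]]; rewrite -[X in measurable X]setTI; exact: mf.
Qed.

Lemma cylinder_unique I (i0 : I) (f : I -> T -> R) J (m1 m2 : {measure set T -> \bar R}) :
  cyl_fun f J -> (m1 setT < +oo)%E ->
  (forall n t A, (forall j, (j < n)%N -> J (t j)) -> (forall j, measurable (A j)) ->
     m1 (rect f n t A) = m2 (rect f n t A)) ->
  forall B : set T, measurable (B : set (gcyl f J)) -> m1 B = m2 B.
Proof.
move=> mf m1T m12 B mB.
pose G := [set B | exists n t A, [/\ forall j, (j < n)%N -> J (t j),
  forall j, measurable (A j) & B = rect f n t A]].
have Gm : G `<=` measurable.
  move=> _ [n [t [A [Jt mA ->]]]]; apply: (gcyl_measurable mf).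
  exact: measurable_rect.
have G1 : G setT.
  by exists 0%N, (fun=> i0), (fun=> setT); split => //; apply/seteqP; split.
apply: (g_sigma_algebra_measure_unique G Gm (fun=> setT)) => //.
- by apply/seteqP; split => // x _; exists 0%N.
- move=> _ _ [n [t [A [Jt mA ->]]]] [n' [t' [A' [Jt' mA' ->]]]].
  exists (n + n')%N, (fun j => if (j < n)%N then t j else t' (j - n)%N),
    (fun j => if (j < n)%N then A j else A' (j - n)%N); split.
  + move=> j jn; case: ltnP => nj; first exact: Jt.
    by apply: Jt'; rewrite ltn_subLR.
  + by move=> j; case: ifP.
  + apply/seteqP; split => [w [wA wA'] j jn|w H].
      case: ltnP => nj; first exact: wA.
      by apply: wA'; rewrite ltn_subLR.
    split=> j jn; first by have := H j (ltn_addr _ jn); rewrite jn.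
    have := H (n + j)%N; by rewrite ltn_add2l (ltnNge (n + j)) leq_addr /= addKn; exact.
- by move=> _ [n [t [A [Jt mA ->]]]]; exact: m12.
- apply: sub_sigma_algebra2 mB => _ [i Ji [A mA ->]].
  exists 1%N, (fun=> i), (fun=> A); split => //.
  by apply/seteqP; split => [w Aw []//|w /(_ 0%N)]; exact.
Qed.

Variable P : probability T R.

(** One family at a time: for a fixed [B'] both sides are finite measures in [B], a restriction and
    a multiple of [P], and agreement on rectangles suffices. Then the roles are exchanged. *)
Lemma cylinder_indep I I' (i0 : I) (i0' : I') (f : I -> T -> R) (f' : I' -> T -> R) J J' :
  cyl_fun f J -> cyl_fun f' J' ->
  (forall n t A n' t' A', (forall j, (j < n)%N -> J (t j)) -> (forall j, measurable (A j)) ->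
     (forall j, (j < n')%N -> J' (t' j)) -> (forall j, measurable (A' j)) ->
     P (rect f n t A `&` rect f' n' t' A') = (P (rect f n t A) * P (rect f' n' t' A'))%E) ->
  forall B B' : set T, measurable (B : set (gcyl f J)) ->
    measurable (B' : set (gcyl f' J')) -> P (B `&` B') = (P B * P B')%E.
Proof.
move=> mf mf' H.
suff key I1 (i1 : I1) (g : I1 -> T -> R) (J1 : set I1) (B B' : set T) :
    cyl_fun g J1 -> measurable B' ->
    (forall n t A, (forall j, (j < n)%N -> J1 (t j)) -> (forall j, measurable (A j)) ->
     P (rect g n t A `&` B') = (P (rect g n t A) * P B')%E) ->
    measurable (B : set (gcyl g J1)) -> P (B `&` B') = (P B * P B')%E.
  move=> B B' mB mB'; apply: (key I i0 f J) => // [|n t A Jt mA].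
    exact: (gcyl_measurable mf').
  rewrite setIC muleC; apply: (key I' i0' f' J') => //.
    by apply: (gcyl_measurable mf); exact: measurable_rect.
  by move=> n' t' A' Jt' mA'; rewrite setIC muleC H.
move=> mg mB' gB mB.
have Pf : (0 <= fine (P B'))%R by exact: fine_ge0.
pose m1 := mrestr P mB'; pose m2 := mscale (NngNum Pf) P.
have m2E C : m2 C = (P C * P B')%E.
  by rewrite /m2 /mscale /= fineK ?fin_num_measure// muleC.
suff : m1 B = m2 B by rewrite m2E.
apply: (cylinder_unique i1 mg) mB => //.
  by rewrite /= /mrestr setTI; exact: le_lt_trans (probability_le1 _ _) (ltry _).
by move=> n t A Jt mA; rewrite [RHS]m2E -gB.
Qed.

End cylinder_unique.

(** * Finite-dimensional laws of Levy processes *)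

Section levy.
Context d (T : measurableType d) (R : realType) (P : probability T R).
Implicit Types (X : levy_process P).

Section shifted.
Variables (X : levy_process P) (r : R).
Hypothesis r0 : 0 <= r.

Let Y (t : R) (w : T) : R := X (r + t) w - X r w.

Let Y_measurable t : 0 <= t -> measurable_fun setT (Y t).
Proof.
by move=> t0; apply: measurable_funB; apply: levy_measurable; rewrite ?addr_ge0.
Qed.

Let Y_start w : Y 0 w = 0.
Proof. by rewrite /Y addr0 subrr. Qed.

Let Y_rcont w (u : R) : 0 <= u -> Y v w @[v --> u^'+] --> Y u w.
Proof.
move=> u0; rewrite /Y; apply: cvgB; last exact: cvg_cst.
have ru : 0 <= r + u by rewrite addr_ge0.
apply: (cvg_trans _ (@levy_rcont _ _ _ _ X w (r + u) ru)) => A /=.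
rewrite /nbhs /= /at_right /within /= => -[e e0 eA].
exists e => //= v /= uv ltv; apply: (eA (r + v)) => /=; last by rewrite ltrD2l.
by rewrite opprD addrACA subrr add0r.
Qed.

Let Y_llim w (u : R) : 0 < u -> cvg (Y v w @[v --> u^'-]).
Proof.
move=> u0; rewrite /Y; apply: is_cvgB; last exact: is_cvg_cst.
have ru : 0 < r + u by rewrite ltr_wpDl.
suff : X (r + v) w @[v --> u^'-] --> lim (X v w @[v --> (r + u)^'-]) by move/cvgP.
apply: (cvg_trans _ (@levy_llim _ _ _ _ X w (r + u) ru)) => A /=.
rewrite /nbhs /= /at_left /within /= => -[e e0 eA].
exists e => //= v /= uv ltv; apply: (eA (r + v)) => /=; last by rewrite ltrD2l.
by rewrite opprD addrACA subrr add0r.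
Qed.

Let Y_incr s t w : Y t w - Y s w = X (r + t) w - X (r + s) w.
Proof. by rewrite /Y; ring. Qed.

Let Y_stationary (s h : R) (B : set R) : 0 <= s -> 0 <= h -> measurable B ->
  P [set w | B (Y (s + h) w - Y s w)] = P [set w | B (Y h w)].
Proof.
move=> s0 h0 mB.
rewrite (_ : [set w | B (Y (s + h) w - _)] =
  [set w | B (X ((r + s) + h) w - X (r + s) w)]); last first.
  by apply/seteqP; split=> w /=; rewrite Y_incr addrA.
by rewrite /Y !levy_stationary// addr_ge0.
Qed.

Let Y_independent n (t : nat -> R) (B : nat -> set R) : 0 <= t 0%N ->
  (forall i, (i < n)%N -> t i <= t i.+1) -> (forall i, measurable (B i)) ->
  P [set w | forall i, (i < n)%N -> B i (Y (t i.+1) w - Y (t i) w)] =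
  (\prod_(i < n) P [set w | B i (Y (t i.+1) w - Y (t i) w)%R])%E.
Proof.
move=> t0 tS mB.
rewrite (_ : [set w | _] = [set w | forall i, (i < n)%N ->
  B i (X (r + t i.+1) w - X (r + t i) w)]); last first.
  by apply/seteqP; split=> w /= H i /H; rewrite Y_incr.
rewrite (@levy_independent _ _ _ _ X n (fun i => r + t i))//.
- by apply: eq_bigr => i _; congr (P _); apply/seteqP; split=> w /=; rewrite Y_incr.
- by rewrite addr_ge0.
- by move=> i /tS; rewrite lerD2l.
Qed.

(** With the increments after [r] packed as a process again, the path after [r] is an instance of
    [levy_path] and has the law of the path from time 0. *)
Definition shifted : levy_process P := LevyProcess Y_measurable Y_start Y_rcont
  Y_llim Y_stationary Y_independent.

End shifted.

Section grid.

(** Independence is available along increasing times only. Arbitrary finite families of times are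
    embedded in a sorted grid, with 0 added so that each value is a sum of grid increments. *)
Lemma grid_exists (s : seq R) : (forall x, x \in s -> 0 <= x) ->
  exists N (g : nat -> R), [/\ g 0%N = 0, forall i, (i < N)%N -> g i <= g i.+1 &
    forall x, x \in s -> exists2 i, (i <= N)%N & g i = x].
Proof.
move=> s0; pose q := sort <=%R (0 :: s).
have sq : sorted <=%R q by apply: sort_sorted; exact: le_total.
have memq x : (x \in q) = (x \in 0 :: s) by rewrite mem_sort.
have szq : size q = (size s).+1 by rewrite size_sort.
exists (size s), (nth 0 q); split.
- have i0 : (0 < size q)%N by rewrite szq.
  have : nth 0 q 0 \in 0 :: s by rewrite -memq mem_nth.
  rewrite in_cons => /predU1P[//|/s0 h]; apply/eqP; rewrite eq_le h andbT.
  have zq : 0 \in q by rewrite memq mem_head.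
  rewrite -[leRHS](nth_index 0 zq); apply: sorted_leq_nth => //.
  - exact: le_trans.
  - by rewrite inE index_mem.
- move=> i iN; apply: sorted_leq_nth => //; first exact: le_trans.
    by rewrite inE szq ltnS ltnW.
  by rewrite inE szq ltnS.
- move=> x xs; have xq : x \in q by rewrite memq in_cons xs orbT.
  exists (index x q); last exact: nth_index.
  by rewrite -ltnS -szq index_mem.
Qed.

Lemma grid_le N (g : nat -> R) : (forall i, (i < N)%N -> g i <= g i.+1) ->
  forall i j, (i <= j <= N)%N -> g i <= g j.
Proof.
move=> gS i; elim=> [|j IH] /andP[ij jN]; first by move: ij; rewrite leqn0 => /eqP->.
move: ij; rewrite leq_eqVlt => /predU1P[->//|ij].
by apply: le_trans (gS _ jN); apply: IH; rewrite -ltnS ij ltnW.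
Qed.

Variables (X : levy_process P) (N : nat) (g : nat -> R).
Hypotheses (g0 : g 0%N = 0) (gS : forall i, (i < N)%N -> g i <= g i.+1).

Definition incr i (w : T) : R := X (g i.+1) w - X (g i) w.

Lemma grid_ge0 i : (i <= N)%N -> 0 <= g i.
Proof. by move=> iN; rewrite -g0; apply: (grid_le gS). Qed.

Lemma incr_fun : cyl_fun incr [set i | (i < N)%N].
Proof.
by move=> i /= iN; apply: measurable_funB; apply: levy_measurable;
  apply: grid_ge0 => //; exact: ltnW.
Qed.

Lemma incr_sum i j w : (i <= j)%N -> X (g j) w - X (g i) w = \sum_(i <= l < j) incr l w.
Proof. by move=> ij; rewrite telescope_sumr. Qed.

(** All conditions on one increment are gathered in a single set, which is everything if no index
    points to that increment; this is the product form to which independence of increments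
    applies. *)
Lemma rect_nat (J : set nat) n t A : (forall j, (j < n)%N -> J (t j)) -> J `<=` `I_N ->
  rect incr n t A = [set w | forall i, (i < N)%N ->
    [set y | forall j, (j < n)%N -> t j = i -> A j y] (incr i w)].
Proof.
move=> Jt JN; apply/seteqP; split => w H /=.
  by move=> i iN j jn tj; rewrite -tj; exact: H.
by move=> j jn; apply: (H (t j)) => //; apply: JN; exact: Jt.
Qed.

Lemma measurable_fiber_cond (n : nat) (t : nat -> nat) (A : nat -> set R) i :
  (forall j, measurable (A j)) ->
  measurable [set y | forall j, (j < n)%N -> t j = i -> A j y].
Proof.
move=> mA; rewrite (_ : [set y | _] = \bigcap_j
    (if ((j < n)%N && (t j == i)) then A j else setT)); last first.
  apply/seteqP; split => [y H j _|y H j jn tj].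
    by case: ifP => // /andP[jn /eqP]; exact: H.
  by have := H j I; rewrite jn tj eqxx.
by apply: bigcapT_measurable => j; case: ifP.
Qed.

Lemma prob_incr (B : nat -> set R) : (forall i, measurable (B i)) ->
  P [set w | forall i, (i < N)%N -> B i (incr i w)] =
  (\prod_(i < N) P [set w | B i (incr i w)])%E.
Proof. by move=> mB; apply: levy_independent => //; rewrite g0. Qed.

(** Disjointness of [M] and [M'] leaves each increment with a genuine condition in at most one of
    the two rectangles, so the product over the grid splits factor by factor. *)
Lemma incr_indep (M M' : set nat) : M `<=` `I_N -> M' `<=` `I_N ->
  (forall i, M i -> ~ M' i) ->
  forall B B' : set T, measurable (B : set (gcyl incr M)) ->
    measurable (B' : set (gcyl incr M')) -> P (B `&` B') = (P B * P B')%E.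
Proof.
move=> MN MN' MM'; apply: (cylinder_indep 0%N 0%N).
- by move=> i /MN; exact: incr_fun.
- by move=> i /MN'; exact: incr_fun.
move=> n t A n' t' A' Mt mA Mt' mA'.
pose B i := [set y | forall j, (j < n)%N -> t j = i -> A j y].
pose B' i := [set y | forall j, (j < n')%N -> t' j = i -> A' j y].
have mB i : measurable (B i) by exact: measurable_fiber_cond.
have mB' i : measurable (B' i) by exact: measurable_fiber_cond.
have -> : rect incr n t A = [set w | forall i, (i < N)%N -> B i (incr i w)].
  exact: (rect_nat _ Mt MN).
have -> : rect incr n' t' A' = [set w | forall i, (i < N)%N -> B' i (incr i w)].
  exact: (rect_nat _ Mt' MN').
have -> : [set w | forall i, (i < N)%N -> B i (incr i w)] `&`
    [set w | forall i, (i < N)%N -> B' i (incr i w)] =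
    [set w | forall i, (i < N)%N -> (B i `&` B' i) (incr i w)].
  apply/seteqP; split => [w [H H'] i iN|w H]; first by split; [exact: H|exact: H'].
  by split=> i /H[].
rewrite (prob_incr mB) (prob_incr mB').
rewrite (prob_incr (fun i => measurableI _ _ (mB i) (mB' i))).
rewrite -big_split /=; apply: eq_bigr => i _.
have prob1 C : (forall y, C y) -> P [set w | C (incr i w)] = 1%E.
  move=> CT; rewrite (_ : [set w | _] = setT) ?probability_setT//.
  by apply/seteqP; split => // w _; exact: CT.
have [Mi|nMi] := pselect (M i).
- have BT y : B' i y.
    by move=> j jn tj; case: (MM' _ Mi); rewrite -tj; exact: Mt'.
  rewrite (prob1 _ BT) mule1; congr (P _).
  by apply/seteqP; split => [w []//|w Bw]; split => //; exact: BT.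
- have BT y : B i y by move=> j jn tj; case: nMi; rewrite -tj; exact: Mt.
  rewrite (prob1 _ BT) mul1e; congr (P _).
  by apply/seteqP; split => [w []//|w Bw]; split => //; exact: BT.
Qed.

Lemma measurable_incr_sum (M : set nat) i j : (forall l, (i <= l < j)%N -> M l) ->
  measurable_fun setT ((fun w => \sum_(i <= l < j) incr l w) : gcyl incr M -> R).
Proof.
move=> HM.
have -> : ((fun w => \sum_(i <= l < j) incr l w) : gcyl incr M -> R) =
    (fun w => \sum_(l <- index_iota i j) (if (i <= l < j)%N then incr l w else 0)).
  apply/funext => w; rewrite big_nat_cond [RHS]big_nat_cond.
  by apply: eq_bigr => l; rewrite andbT => ->.
apply: measurable_sum => l; case: (boolP (i <= l < j)%N) => // lij.
by apply: measurable_coord; exact: HM.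
Qed.

End grid.

(** A rectangle of values is not a rectangle of increments. Both processes are sent to the space [S]
    of increment vectors, whose law is fixed by independence and stationarity; there the event is
    the measurable set [E]. *)
Lemma levy_rect_law X X' :
  (forall h B, 0 <= h -> measurable B -> P [set w | B (X h w)] = P [set w | B (X' h w)]) ->
  forall n (t : nat -> R) A, (forall j, (j < n)%N -> 0 <= t j) ->
  (forall j, measurable (A j)) -> P (rect X n t A) = P (rect X' n t A).
Proof.
move=> XX' n t A t0 mA.
have [x|N [g [g0 gS gt]]] := @grid_exists [seq t j | j <- iota 0 n].
  by move=> /mapP[j]; rewrite mem_iota => /andP[_ jn] ->; exact: t0.
have {gt} [id_ idP] : exists i_ : nat -> nat, forall j, (j < n)%N ->
    (i_ j <= N)%N /\ g (i_ j) = t j.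
  suff H j : exists i, (j < n)%N -> (i <= N)%N /\ g i = t j.
    have [F FP] := choice H; by exists F.
  case: (ltnP j n) => jn; last by exists 0%N.
  have [|i iN it] := gt (t j); last by exists i.
  by apply/mapP; exists j => //; rewrite mem_iota.
pose S := gcyl (fun i (x : nat -> R) => x i) `I_N.
pose D (Z : levy_process P) (w : T) : S := fun i => incr Z g i w.
have mD Z : measurable_fun setT (D Z).
  by apply: measurable_gcyl => i iN; exact: (incr_fun Z g0 gS iN).
pose E : set S := [set x | forall j, (j < n)%N -> A j (\sum_(0 <= l < id_ j) x l)].
have mE : measurable E.
  rewrite (_ : E = \bigcap_j (if (j < n)%N then
     (fun x : S => \sum_(0 <= l < id_ j) x l) @^-1` A j else setT)); last first.
    apply/seteqP; split => [x Ex j _|x Ex j jn]; first by case: ifP => //; exact: Ex.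
    by have := Ex j I; rewrite jn.
  apply: bigcapT_measurable => j; case: ifPn => // jn.
  rewrite -[X in measurable X]setTI.
  suff : measurable_fun setT (fun x : S => \sum_(0 <= l < id_ j) x l) by exact.
  have -> : (fun x : S => \sum_(0 <= l < id_ j) x l) =
      (fun x : S => \sum_(l <- index_iota 0 (id_ j)) (if (l < N)%N then x l else 0)).
    apply/funext => x; rewrite big_nat_cond [RHS]big_nat_cond.
    apply: eq_bigr => l; rewrite andbT => /andP[_ lj].
    by rewrite (leq_trans lj)//; have [] := idP j jn.
  apply: measurable_sum => l; case: (boolP (l < N)%N) => // lN.
  exact: (@measurable_coord _ _ _ (fun i (x : nat -> R) => x i) `I_N l).
have rE (Z : levy_process P) : rect (Z : R -> T -> R) n t A = D Z @^-1` E.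
  apply/seteqP; split => w H j jn; have [_ ij] := idP j jn;
    have := H j jn; rewrite -(incr_sum Z g w (leq0n _)) g0 levy_start subr0 ij; exact.
rewrite !rE.
suff : pushforward P (D X) E = pushforward P (D X') E by [].
apply: (@cylinder_unique _ S _ _ 0%N (fun i (x : nat -> R) => x i) `I_N
  (pushforward P (D X)) (pushforward P (D X'))) => //.
- by move=> i iN; exact: (@measurable_coord _ _ _ (fun i (x : nat -> R) => x i)).
- by rewrite /= /pushforward preimage_setT probability_setT ltry.
- move=> m s B sN mB; rewrite /= /pushforward.
  have rZ Z : D Z @^-1` rect (fun i x => x i) m s B = rect (incr Z g) m s B by [].
  pose C i := [set y | forall j, (j < m)%N -> s j = i -> B j y].
  have mC i : measurable (C i) by exact: measurable_fiber_cond.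
  have rC Z : rect (incr Z g) m s B = [set w | forall i, (i < N)%N -> C i (incr Z g i w)].
    exact: (rect_nat _ _ _ sN (@subset_refl _ _)).
  rewrite !rZ !rC !(prob_incr _ g0 gS)//.
  apply: eq_bigr => -[i iN] _ /=.
  have dec Z : P [set w | C i (incr Z g i w)] = P [set w | C i (Z (g i.+1 - g i) w)].
    rewrite -(@levy_stationary _ _ _ _ Z (g i))//.
    + by rewrite /incr addrC subrK.
    + by apply: (grid_ge0 g0 gS); exact: ltnW.
    + by rewrite subr_ge0 gS.
  by rewrite !dec XX' ?subr_ge0 ?gS.
Qed.

End levy.

(** * Independence of path segments *)

Section levy_paths.
Context d (T : measurableType d) (R : realType) (P : probability T R).
Implicit Types (X : levy_process P).

Definition eval_cadlag (s t u : R) (c : cadlag s t) : R := c u.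

Lemma measurable_cadlag (s t : R) d' (T' : measurableType d') (h : T' -> cadlag s t) :
  (forall u, measurable_fun setT (fun w => path_fun (h w) u)) -> measurable_fun setT h.
Proof.
move=> mh; have := (@measurability _ _ T' (cadlag s t) setT h (@cylinders R s t)).
apply => // _ [_ [u [A mA ->]] <-]; exact: mh.
Qed.

Lemma measurable_eval (s t u : R) : measurable_fun setT (@eval_cadlag s t u).
Proof.
move=> _ A mA; rewrite setTI; apply: sub_sigma_algebra.
by exists u, A.
Qed.

Lemma cadlag_unique (s t : R) (m1 m2 : {measure set (cadlag s t) -> \bar R}) :
  (m1 setT < +oo)%E ->
  (forall n u A, (forall j, measurable (A j)) ->
     m1 (rect (@eval_cadlag s t) n u A) = m2 (rect (@eval_cadlag s t) n u A)) ->
  forall B : set (cadlag s t), measurable B -> m1 B = m2 B.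
Proof.
move=> m1T m12 B mB.
apply: (cylinder_unique (0 : R) (f := @eval_cadlag s t) (J := setT)) => //.
- by move=> u _; exact: measurable_eval.
- by move=> n u A _; exact: m12.
- apply: sub_sigma_algebra2 mB => _ [u [A mA ->]].
  by exists u => //; exists A.
Qed.

Lemma clamp_ge0 (t u : R) : 0 <= clamp 0 t u.
Proof. by rewrite /clamp le_max lexx. Qed.

Lemma clamp_le (s t u : R) : s <= t -> clamp s t u <= t.
Proof. by move=> st; rewrite /clamp ge_max st ge_min lexx orbT. Qed.

Lemma measurable_levy_path X t : measurable_fun setT (levy_path X t).
Proof.
by apply: measurable_cadlag => u; apply: levy_measurable; exact: clamp_ge0.
Qed.

Lemma levy_path_law X X' t :
  (forall h B, 0 <= h -> measurable B -> P [set w | B (X h w)] = P [set w | B (X' h w)]) ->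
  forall B, measurable B -> P (levy_path X t @^-1` B) = P (levy_path X' t @^-1` B).
Proof.
move=> XX' B mB.
have mX := @measurable_levy_path X t; have mX' := @measurable_levy_path X' t.
suff : pushforward P (levy_path X t) B = pushforward P (levy_path X' t) B by [].
apply: (@cadlag_unique _ _ (pushforward P (levy_path X t)) (pushforward P (levy_path X' t))) => //.
  by rewrite /= /pushforward preimage_setT probability_setT ltry.
move=> n u A mA.
by apply: (levy_rect_law XX' (t := fun j => clamp 0 t (u j))) => // j _; exact: clamp_ge0.
Qed.

Variables (X : levy_process P) (r delta : R).
Hypotheses (r0 : 0 <= r) (delta0 : 0 < delta).

(* Recentring at [r + delta] makes the family independent of the increments over
   [r, r + delta]. *)
Definition outside_incr (v : R) (w : T) : R :=
  if v <= r then X v w else X v w - X (r + delta) w.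

Definition outside : set R := [set v | 0 <= v <= r \/ r + delta <= v].

Lemma outside_incr_fun : cyl_fun outside_incr outside.
Proof.
move=> v [/andP[v0 vr]|rv]; rewrite /outside_incr.
  by under eq_fun do rewrite vr; exact: levy_measurable.
have vr : (v <= r) = false by apply/negbTE; rewrite -ltNge (lt_le_trans _ rv) ?ltrDl.
under eq_fun do rewrite vr.
have rd0 : 0 <= r + delta by rewrite addr_ge0// ltW.
by apply: measurable_funB; apply: levy_measurable => //; exact: le_trans rv.
Qed.

Let inside : set R := [set u | 0 <= u <= delta].

(** On a grid through all times involved and both ends of the segment, the inside family reads the
    increments with index in [[p, q)], the recentred outside family only the others. *)
Lemma inside_indep (B B' : set T) :
  measurable (B : set (gcyl (shifted X r0) inside)) ->
  measurable (B' : set (gcyl outside_incr outside)) ->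
  P (B `&` B') = (P B * P B')%E.
Proof.
apply: (cylinder_indep (0 : R) (0 : R)).
- by move=> u /andP[u0 _]; exact: levy_measurable.
- exact: outside_incr_fun.
move=> n t A n' t' A' Jt mA Jt' mA'.
have r0' := r0; have delta0' := delta0.
have rd0 : 0 <= r + delta by rewrite addr_ge0 // ltW.
have [x|N [g [g0 gS gt]]] := @grid_exists R
    (r :: (r + delta) :: [seq r + t j | j <- iota 0 n] ++ [seq t' j | j <- iota 0 n']).
  rewrite !in_cons => /predU1P[->//|/predU1P[->//|]].
  rewrite mem_cat => /orP[] /mapP[j]; rewrite mem_iota => /andP[_ jn] ->.
    by rewrite addr_ge0//; case/andP: (Jt _ jn).
  by case: (Jt' _ jn) => [/andP[]//|]; exact: le_trans.
have gle := grid_le gS.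
have [p pN gp] : exists2 i, (i <= N)%N & g i = r.
  by apply: gt; rewrite mem_head.
have [q qN gq] : exists2 i, (i <= N)%N & g i = r + delta.
  by apply: gt; rewrite !in_cons eqxx orbT.
have gt1 j : (j < n)%N -> exists2 i, (i <= N)%N & g i = r + t j.
  move=> jn; apply: gt; rewrite !in_cons mem_cat; apply/orP; right; apply/orP; right.
  by apply/orP; left; apply/mapP; exists j => //; rewrite mem_iota.
have gt2 j : (j < n')%N -> exists2 i, (i <= N)%N & g i = t' j.
  move=> jn; apply: gt; rewrite !in_cons mem_cat; apply/orP; right; apply/orP; right.
  by apply/orP; right; apply/mapP; exists j => //; rewrite mem_iota.
have pq : (p < q)%N.
  rewrite ltnNge; apply/negP => qp; have := gle q p.
  by rewrite qp pN gp gq => /(_ isT); lra.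
pose M := [set i | (p <= i < q)%N]; pose M' := [set i | (i < N)%N /\ ~ M i].
have MN : M `<=` `I_N by move=> i /andP[_ iq] /=; exact: leq_trans qN.
apply: (incr_indep g0 gS MN (M' := M')) => [i []//|i Mi []//||].
- rewrite rect_bigcap.
  have -> : \bigcap_(j in [set j | (j < n)%N]) (shifted X r0 (t j) @^-1` A j) =
      \bigcap_j (if (j < n)%N then shifted X r0 (t j) @^-1` A j else setT).
    apply/seteqP; split => [w H j _|w H j jn]; first by case: ifP => //; exact: H.
    by have := H j I; rewrite jn.
  apply: bigcapT_measurable => j; case: (ltnP j n) => // jn.
  have [i iN gi] := gt1 _ jn; have /andP[tj0 tjd] := Jt _ jn.
  (* The grid may repeat values, so the index found for a time inside can fall outside [[p, q]];
     that time is then an end of the segment and the index of that end serves. *)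
  have [i' pi'q gi'] : exists2 i', (p <= i' <= q)%N & g i' = r + t j.
    have [ip|pi] := leqP i p.
      exists p; first by rewrite leqnn ltnW.
      apply/eqP; rewrite eq_le -{2}gi gle ?ip// andbT gp; lra.
    have [qi|iq] := leqP q i; last by exists i => //; rewrite (ltnW pi) (ltnW iq).
    exists q; first by rewrite leqnn ltnW.
    by apply/eqP; rewrite eq_le -{1}gi gle ?qi// gq; lra.
  have /andP[pi' iq'] := pi'q.
  suff : measurable_fun setT (shifted X r0 (t j) : gcyl (incr X g) M -> R).
    by move=> mf; rewrite -[X in measurable X]setTI; exact: mf.
  have -> : (shifted X r0 (t j) : gcyl (incr X g) M -> R) =
      (fun w => \sum_(p <= l < i') incr X g l w).
    by apply/funext => w; rewrite -incr_sum// gp gi'.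
  apply: measurable_incr_sum => l /andP[pl li] /=.
  by apply/andP; split => //; exact: leq_trans iq'.
- rewrite rect_bigcap.
  have -> : \bigcap_(j in [set j | (j < n')%N]) (outside_incr (t' j) @^-1` A' j) =
      \bigcap_j (if (j < n')%N then outside_incr (t' j) @^-1` A' j else setT).
    apply/seteqP; split => [w H j _|w H j jn]; first by case: ifP => //; exact: H.
    by have := H j I; rewrite jn.
  apply: bigcapT_measurable => j; case: (ltnP j n') => // jn.
  have [i iN gi] := gt2 _ jn.
  suff : measurable_fun setT (outside_incr (t' j) : gcyl (incr X g) M' -> R).
    by move=> mf; rewrite -[X in measurable X]setTI; exact: mf.
  case: (Jt' _ jn) => [/andP[tj0 tjr]|rtj].
  + have [i' i'p gi'] : exists2 i', (i' <= p)%N & g i' = t' j.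
      have [ip|pi] := leqP i p; first by exists i.
      exists p => //; apply/eqP; rewrite eq_le -{1}gi gle ?(ltnW pi)//= gp.
      exact: tjr.
    have -> : (outside_incr (t' j) : gcyl (incr X g) M' -> R) =
        (fun w => \sum_(0 <= l < i') incr X g l w).
      apply/funext => w.
      by rewrite -incr_sum// g0 levy_start subr0 gi' /outside_incr tjr.
    apply: measurable_incr_sum => l /andP[_ li]; split => /=.
      by rewrite (leq_trans li)// (leq_trans i'p).
    by move=> /andP[pl _]; have := leq_trans li i'p; rewrite ltnNge pl.
  + have [i' /andP[qi' i'N] gi'] : exists2 i', (q <= i' <= N)%N & g i' = t' j.
      have [qi|iq] := leqP q i; first by exists i => //; rewrite qi.
      exists q; first by rewrite leqnn.
      by apply/eqP; rewrite eq_le -{2}gi gle ?(ltnW iq)// andbT gq.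
    have -> : (outside_incr (t' j) : gcyl (incr X g) M' -> R) =
        (fun w => \sum_(q <= l < i') incr X g l w).
      apply/funext => w; rewrite -incr_sum// gi' gq /outside_incr ifF//.
      by apply/negbTE; rewrite -ltNge; lra.
    apply: measurable_incr_sum => l /andP[ql li]; split => /=.
      exact: leq_trans i'N.
    by move=> /andP[_]; rewrite ltnNge ql.
Qed.

Lemma segment_indep (B : set (cadlag 0 delta)) (B' : set T) : measurable B ->
  measurable (B' : set (gcyl outside_incr outside)) ->
  P (B' `&` levy_path (shifted X r0) delta @^-1` B) =
  (P B' * P (levy_path X delta @^-1` B))%E.
Proof.
move=> mB mB'; rewrite -(@levy_path_law (shifted X r0) X)//; last first.
  by move=> h C h0 mC; rewrite -(levy_stationary X r0 h0 mC).
rewrite setIC muleC; apply: inside_indep => //.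
rewrite -[X in measurable X]setTI.
suff : measurable_fun setT
    (levy_path (shifted X r0) delta : gcyl (shifted X r0) inside -> cadlag 0 delta) by exact.
apply: measurable_cadlag => u.
apply: (measurable_coord (f := shifted X r0) (i := clamp 0 delta u)).
by apply/andP; split; [exact: clamp_ge0|apply: clamp_le; exact: ltW].
Qed.

End levy_paths.

(** * Integrals and disintegration *)

Section sub_sigma_algebra.
Context d (T : measurableType d) (R : realType) (mu : {measure set T -> \bar R}).
Variables (G : set_system T) (f1 f2 : T -> \bar R).
Hypothesis GT : G `<=` measurable.
Hypotheses (f10 : forall w, (0 <= f1 w)%E) (f20 : forall w, (0 <= f2 w)%E).
Hypotheses (mf1 : measurable_fun setT f1) (mf2 : measurable_fun setT f2).
Hypotheses (f1fin : forall w, f1 w \is a fin_num) (f2fin : forall w, f2 w \is a fin_num).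
Hypothesis f12 : forall H, <<s G >> H ->
  (\int[mu]_(w in H) f1 w = \int[mu]_(w in H) f2 w)%E.

Let GTs H : <<s G >> H -> measurable H.
Proof. by apply: smallest_sub => //; exact: sigma_algebra_measurable. Qed.

Import HBNNSimple.

Lemma measurable_sub_sigma d' (U : measurableType d') (g : T -> U) :
  measurable_fun setT (g : g_sigma_algebraType G -> U) -> measurable_fun setT g.
Proof. by move=> mg _ B mB; apply: GTs; exact: (mg measurableT B mB). Qed.

(** [f1] and [f2] have the same conditional expectation given [G]. The approximating simple
    functions are built for the coarser sigma-algebra, so that the hypothesis applies to their level
    sets. *)
Lemma sub_sigma_integral (g : T -> \bar R) :
  measurable_fun setT (g : g_sigma_algebraType G -> \bar R) ->
  (forall w, 0 <= g w)%E ->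
  (\int[mu]_w (g w * f1 w) = \int[mu]_w (g w * f2 w))%E.
Proof.
move=> mg g0; pose h := nnsfun_approx (T := g_sigma_algebraType G) measurableT mg.
pose D n y : set T := h n @^-1` [set y].
have mh n : measurable_fun setT (h n : T -> R) by exact: measurable_sub_sigma.
have simple n : (\int[mu]_w ((h n w)%:E * f1 w) = \int[mu]_w ((h n w)%:E * f2 w))%E.
  have decomp (f : T -> \bar R) : (forall w, 0 <= f w)%E -> measurable_fun setT f ->
      (\int[mu]_w ((h n w)%:E * f w) = \sum_(y \in range (h n))
        (y%:E * \int[mu]_(w in D n y) f w))%E.
    move=> f0 mf; transitivity (\int[mu]_w (\sum_(y \in range (h n))
        (y%:E * (f \_ (D n y)) w)))%E.
      apply: eq_integral => w _.
      rewrite (fsbigD1 (h n w))//=; last by exists w.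
      rewrite patchE mem_set//= fsbig1 ?adde0// => y [_ /= yw].
      by rewrite patchE memNset ?mule0// => /esym.
    have mhy y : measurable (D n y).
      by rewrite -[X in measurable X]setTI; exact: (mh n measurableT _ (measurable_set1 y)).
    have gt0 y : (y \in range (h n)) -> (0 <= y)%R.
      by rewrite inE => -[w _ <-].
    (* Truncation at 0 makes the terms nonnegative for every index [y] and changes none with [y] in
       the range. *)
    pose F y w := ((Num.max y 0)%:E * (f \_ (D n y)) w)%E.
    have fp y w : (0 <= (f \_ (D n y)) w)%E by rewrite patchE; case: ifP.
    have mfp y : measurable_fun setT (f \_ (D n y)).
      by apply/(measurable_restrictT f (mhy y)); exact: measurable_funTS.
    transitivity (\int[mu]_w (\sum_(y \in range (h n)) F y w))%E.
      apply: eq_integral => w _; apply: eq_fsbigr => y /gt0 y0.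
      by rewrite /F (max_idPl y0).
    rewrite ge0_integral_fsum//.
    - apply: eq_fsbigr => y /gt0 y0; rewrite /F (max_idPl y0).
      by rewrite ge0_integralZl_EFin// [in RHS]integral_mkcond.
    - by move=> y; exact: measurable_funeM.
    - by move=> y w _; rewrite mule_ge0// lee_fin le_max lexx orbT.
  rewrite !decomp//; apply: eq_fsbigr => y _; rewrite f12//.
  have := @measurable_funPT _ _ _ _ (h n) measurableT _ (measurable_set1 y).
by rewrite setTI.
have lim (f : T -> \bar R) : (forall w, f w \is a fin_num) -> (forall w, 0 <= f w)%E -> measurable_fun setT f ->
    (\int[mu]_w (g w * f w) = limn (fun n => \int[mu]_w ((h n w)%:E * f w)))%E.
  move=> ffin f0 mf; rewrite -monotone_convergence//.
  - apply: eq_integral => w _; apply/esym/cvg_lim => //.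
    by apply: cvgeZr; [exact: ffin|apply: cvg_nnsfun_approx].
  - by move=> n; apply: emeasurable_funM => //; exact/measurable_EFinP.
  - by move=> n w _; rewrite mule_ge0// lee_fin.
  - move=> w _ m n mn; rewrite lee_wpmul2r// lee_fin.
    by have /lefP := nd_nnsfun_approx measurableT mg mn; exact.
by rewrite !lim//; congr (limn _); apply/funext => n.
Qed.

End sub_sigma_algebra.

(** * Freezing an independent variable *)

Section freezing.
Context d d1 d2 (T : measurableType d) (U : measurableType d1) (V : measurableType d2)
  (R : realType) (P : probability T R).
Variables (Z : T -> U) (W W' : T -> V).
Hypotheses (mZ : measurable_fun setT Z) (mW : measurable_fun setT W)
  (mW' : measurable_fun setT W').
Hypothesis ZW : forall A B, measurable A -> measurable B ->
  P (Z @^-1` A `&` W @^-1` B) = (P (Z @^-1` A) * P (W' @^-1` B))%E.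

(** By hypothesis [(Z, W)] has the product of the laws of [Z] and [W'], and Tonelli integrates out
    the second coordinate. The copy [W'] allows the restarted segment to be exchanged for the one
    from time 0, to which the bridge kernel refers. *)
Lemma freezing (f : U * V -> \bar R) : measurable_fun setT f ->
  (forall p, (0 <= f p)%E) ->
  (\int[P]_w f (Z w, W w) = \int[P]_w \int[P]_w' f (Z w, W' w'))%E.
Proof.
move=> mf f0.
pose Zm : {mfun T >-> U} := HB.pack_for {mfun T >-> U} Z (isMeasurableFun.Build _ _ _ _ Z mZ).
pose Wm : {mfun T >-> V} := HB.pack_for {mfun T >-> V} W' (isMeasurableFun.Build _ _ _ _ W' mW').
have mZW : measurable_fun setT (fun w => (Z w, W w)) by exact: measurable_fun_pair.
pose PZ := distribution P Zm; pose PW := distribution P Wm.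
transitivity (\int[pushforward P (fun w => (Z w, W w))]_p f p)%E.
  by rewrite ge0_integral_pushforward// preimage_setT.
transitivity (\int[(PZ \x PW)%E]_p f p)%E.
  apply: eq_measure_integral => A mA _; apply/esym/product_measure_unique => //=.
rewrite (fubini_tonelli1 f mf f0).
have mF := measurable_fun_fubini_tonelli_F (m2 := PW) f mf f0.
have F0 x : (0 <= fubini_F PW f x)%E by exact: integral_ge0.
have := @ge0_integral_pushforward _ _ _ _ _ _ mZ P setT _ measurableT mF (fun x _ => F0 x).
rewrite preimage_setT => ->; apply: eq_integral => w _ /=.
have := @ge0_integral_pushforward _ _ _ _ _ _ mW' P setT (fun y => f (Z w, y))
  measurableT (measurableT_comp mf (measurable_pair1 (Z w))) (fun y _ => f0 _).
by rewrite preimage_setT => <-.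
Qed.

End freezing.

Section kernel_section.
Context d d' (U : measurableType d) (V : measurableType d') (R : realType).
Variable k : R.-pker R ~> V.

(** Carrying the section's parameter as an idle argument of the kernel turns a moving section into
    the section of one fixed product set. *)
Let k2 (p : U * R) : {measure set V -> \bar R} := k p.2.

Let k2_measurable B : measurable B -> measurable_fun setT (k2 ^~ B).
Proof.
by move=> mB; apply: (measurableT_comp (measurable_kernel k B mB)); exact: measurable_snd.
Qed.

HB.instance Definition _ := isKernel.Build _ _ (U * R)%type V R k2 k2_measurable.

Let k2_uub : measure_fam_uub k2.
(* The uniform bound has to be strict, hence 2 for a mass of 1. *)
Proof. by exists 2%R => p; rewrite /k2 prob_kernel lte_fin ltr1n. Qed.

HB.instance Definition _ := Kernel_isFinite.Build _ _ (U * R)%type V R k2 k2_uub.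

Lemma measurable_kernel_section (A : set (U * V)) : measurable A ->
  measurable_fun setT (fun p : U * R => k p.2 [set v | A (p.1, v)]).
Proof.
move=> mA; pose B : set ((U * R) * V) := [set q | A (q.1.1, q.2)].
have mB : measurable B.
  have : measurable_fun setT (fun q : (U * R) * V => (q.1.1, q.2)).
    by apply: measurable_fun_pair => //; exact: measurableT_comp.
  by move=> /(_ measurableT _ mA); rewrite setTI.
have := @measurable_fun_xsection_finite_kernel _ _ _ _ _ k2 B (mem_set mB).
congr measurable_fun; apply/funext => p; congr (k2 p _).
by apply/seteqP; split => v /=; rewrite /xsection /= inE.
Qed.

End kernel_section.

(** * Bridges on one segment *)

Lemma in_set_iff (T U : Type) (A : set T) (B : set U) x y : (A x <-> B y) ->
  (x \in A) = (y \in B).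
Proof. by move=> [AB BA]; apply/idP/idP; rewrite !inE. Qed.

Lemma indic_iff (T U : Type) (R : realType) (A : set T) (B : set U) x y :
  (A x <-> B y) -> \1_A x = \1_B y :> R.
Proof. by move=> AB; rewrite !indicE (in_set_iff AB). Qed.

Section bridge_step.
Context d (T : measurableType d) (R : realType) (P : probability T R).
Variables (X : levy_process P) (r delta : R).
Hypotheses (r0 : 0 <= r) (delta0 : 0 < delta).
Variable k : R.-pker R ~> cadlag 0 delta.
Hypothesis hk : is_bridge_kernel X k.
Variable V : set (R * cadlag 0 delta).
Hypothesis mV : measurable V.

Definition segment : T -> cadlag 0 delta := levy_path (shifted X r0) delta.

(** The kernel describes paths recentred at their starting value, so an event [V] of the actual
    segment is one of the pair of starting value and recentred path. *)
Definition bridge_section (x y : R) : \bar R := k (y - x) [set c | V (x, c)].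

Let clampT : clamp 0 delta delta = delta.
Proof. by rewrite /clamp minxx; apply/max_idPr; exact: ltW. Qed.

Lemma segment_end w : segment w delta = X (r + delta) w - X r w.
Proof. by rewrite /segment /= clampT. Qed.

Lemma measurable_segment : measurable_fun setT segment.
Proof. exact: measurable_levy_path. Qed.

Let mXr : measurable_fun setT (X r). Proof. exact: levy_measurable. Qed.

Let mXrd : measurable_fun setT (X (r + delta)).
Proof. by apply: levy_measurable; rewrite addr_ge0// ltW. Qed.

Lemma measurable_bridge_section :
  measurable_fun setT (fun p : R * R => bridge_section p.1 p.2).
Proof.
have := measurable_kernel_section k mV.
have mp : measurable_fun setT (fun p : R * R => (p.1, p.2 - p.1)).
  by apply: measurable_fun_pair => //; exact: measurable_funB.
by move/(measurableT_comp)/(_ mp).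
Qed.

Let Omega := gcyl (outside_incr X r delta) (outside r delta).

Let out_r : outside r delta r.
Proof. by left; rewrite r0 lexx. Qed.

Let outE w : outside_incr X r delta r w = X r w.
Proof. by rewrite /outside_incr lexx. Qed.

Let mXr' : measurable_fun setT (X r : Omega -> R).
Proof.
have := measurable_coord (f := outside_incr X r delta) out_r.
by congr measurable_fun; apply/funext => w; exact: outE.
Qed.

Let phi (w : T) : Omega * R := (w, X (r + delta) w - X r w).

Let mid : measurable_fun setT (id : T -> Omega).
Proof.
by apply: measurable_gcyl => v ov; apply: outside_incr_fun.
Qed.

(** A value after the segment is its recentred version plus [X r] plus the increment of the segment.
    The outside values thus involve the segment only through its terminal value, the variable on
    which the bridge conditions. *)
Let outside_preimage (H : set T) : measurable (H : set (gcyl X (outside r delta))) ->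
  exists2 H' : set (Omega * R), measurable H' & H = phi @^-1` H'.
Proof.
pose S := preimage_set_system setT phi (@measurable _ (Omega * R)%type).
suff SH : <<s cyl X (outside r delta) >> `<=` S.
  by move=> mH; have [H' mH' <-] := SH _ mH; exists H' => //; rewrite setTI.
apply: smallest_sub; first by apply: sigma_algebra_preimage; exact: sigma_algebra_measurable.
move=> _ [v ov [A mA ->]].
have moi := measurable_coord (f := outside_incr X r delta) ov.
have [vr|vr] := leP v r.
- exists [set p : Omega * R | A (outside_incr X r delta v p.1)].
    have := measurableT_comp moi (@measurable_fst _ _ Omega R).
    by move=> /(_ measurableT A mA); rewrite setTI.
  rewrite setTI; apply/seteqP; split => w /=; by rewrite /outside_incr vr.
- exists [set p : Omega * R | A (outside_incr X r delta v p.1 + (X r p.1 + p.2))].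
    have m1 := measurableT_comp moi (@measurable_fst _ _ Omega R).
    have m2 := measurableT_comp mXr' (@measurable_fst _ _ Omega R).
    have m3 := measurable_funD m1 (measurable_funD m2 (@measurable_snd _ _ Omega R)).
    by move: m3 => /(_ measurableT A mA); rewrite setTI.
  rewrite setTI; apply/seteqP; split => w /=; rewrite /outside_incr leNgt vr /=;
    by rewrite (_ : _ + (X r w + _) = X v w)//; ring.
Qed.

(** Once the recentred outside is frozen at [z], the event [H] becomes a condition [A'] on the
    terminal value and [V] an event [B] of the path; what remains is the defining identity of the
    bridge kernel. *)
Lemma bridge_step_set (H : set T) : measurable (H : set (gcyl X (outside r delta))) ->
  (\int[P]_(w in H) (\1_[set w | V (X r w, segment w)] w)%:E =
   \int[P]_(w in H) bridge_section (X r w) (X (r + delta)%R w))%E.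
Proof.
move=> /outside_preimage[H' mH' ->].
have mseg := measurable_segment.
have mpath : measurable_fun setT (levy_path X delta) by exact: measurable_levy_path.
have mev : measurable_fun setT (fun p : Omega * cadlag 0 delta => path_fun p.2 delta).
  exact: (measurableT_comp (@measurable_eval _ 0 delta delta) measurable_snd).
have mX1 : measurable_fun setT (fun p : Omega * cadlag 0 delta => X r p.1).
  exact: (measurableT_comp mXr' measurable_fst).
pose S1 := [set p : Omega * cadlag 0 delta | H' (p.1, path_fun p.2 delta)].
pose S2 := [set p : Omega * cadlag 0 delta | V (X r p.1, p.2)].
have mS1 : measurable S1.
  have := measurable_fun_pair (@measurable_fst _ _ Omega (cadlag 0 delta)) mev.
  by move=> /(_ measurableT H' mH'); rewrite setTI.
have mS2 : measurable S2.
  have := measurable_fun_pair mX1 (@measurable_snd _ _ Omega (cadlag 0 delta)).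
  by move=> /(_ measurableT V mV); rewrite setTI.
pose kap (p : Omega * cadlag 0 delta) := k (path_fun p.2 delta) [set c | V (X r p.1, c)].
have mkap : measurable_fun setT kap.
  have := measurableT_comp (measurable_kernel_section k mV) (measurable_fun_pair mX1 mev).
  exact.
pose f1 p := ((\1_(S1 `&` S2) p)%:E : \bar R).
pose f2 p := ((\1_S1 p)%:E * kap p)%E.
have mf1 : measurable_fun setT f1.
  by apply/measurable_EFinP; apply: measurable_indic; exact: measurableI.
have mf2 : measurable_fun setT f2.
  apply: emeasurable_funM => //; apply/measurable_EFinP; exact: measurable_indic.
have frz := @freezing _ _ _ T Omega (cadlag 0 delta) R P id segment (levy_path X delta)
  mid mseg mpath (fun A B mA mB => segment_indep r0 delta0 mB mA).
have S1E w : ((w, segment w) \in S1) = (w \in phi @^-1` H').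
  by apply: in_set_iff; rewrite /S1 /= /phi -segment_end.
transitivity (\int[P]_w f1 (w, segment w))%E.
  rewrite integral_mkcond; apply: eq_integral => w _; rewrite patchE /f1 -S1E.
  case: ifPn => [|/negP] wS; last by rewrite indicE in_setI (negbTE (introN idP wS)).
  by congr (_%:E); apply: indic_iff; rewrite inE in wS; split => [?|[]//]; split.
transitivity (\int[P]_w f2 (w, segment w))%E; last first.
  rewrite [RHS]integral_mkcond; apply: eq_integral => w _; rewrite patchE /f2 indicE S1E.
  by case: ifP => _; rewrite ?mul1e ?mul0e// /kap /bridge_section -segment_end.
rewrite frz//; last by move=> p; rewrite /f1 lee_fin.
rewrite [RHS]frz//; last by move=> p; rewrite /f2 mule_ge0// lee_fin.
apply: eq_integral => z _.
pose A' := [set y | H' (z, y)]; pose B := [set c | V (X r z, c)].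
have mA' : measurable A'.
  by have := measurable_pair1 (z : Omega) measurableT mH'; rewrite setTI.
have mB : measurable B.
  by have := measurable_pair1 (X r z) measurableT mV; rewrite setTI.
have mXd : measurable_fun setT (X delta) by apply: levy_measurable; exact: ltW.
have mXA : measurable [set w | A' (X delta w)].
  by rewrite -[X in measurable X]setTI; exact: mXd.
have mXB : measurable [set w | B (levy_path X delta w)].
  by rewrite -[X in measurable X]setTI; exact: mpath.
transitivity (P [set w | A' (X delta w) /\ B (levy_path X delta w)]).
  rewrite -[X in P X]setIT -integral_indic//; last exact: measurableI.
  apply: eq_integral => w _; congr (_%:E); apply: indic_iff.
  by rewrite /S1 /S2 /setI /= clampT.
rewrite hk// integral_mkcond; apply: eq_integral => w _; rewrite patchE /f2 /kap /= clampT.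
rewrite indicE (_ : ((z, _) \in S1) = (w \in [set w | A' (X delta w)])); last first.
  by apply: in_set_iff; rewrite /S1 /= clampT.
by case: ifP => _; rewrite ?mul1e ?mul0e.
Qed.

End bridge_step.

(** * Chains of bridges *)

Section bridge_step_fun.
Context d (T : measurableType d) (R : realType) (P : probability T R).
Variables (X : levy_process P) (r delta : R).
Hypotheses (r0 : 0 <= r) (delta0 : 0 < delta).
Variable k : R.-pker R ~> cadlag 0 delta.
Hypothesis hk : is_bridge_kernel X k.
Variable V : set (R * cadlag 0 delta).
Hypothesis mV : measurable V.

Lemma measurable_section2 x : measurable [set c | V (x, c)].
Proof. by have := measurable_pair1 x measurableT mV; rewrite setTI. Qed.

Lemma bridge_section_ge0 x y : (0 <= bridge_section k V x y)%E.
Proof. exact: measure_ge0. Qed.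

Lemma bridge_section_le1 x y : (bridge_section k V x y <= 1)%E.
Proof.
rewrite -(@prob_kernel _ _ _ _ _ k (y - x)); apply: le_measure; rewrite ?inE//.
exact: measurable_section2.
Qed.

Lemma bridge_step (g : T -> \bar R) :
  measurable_fun setT (g : gcyl X (outside r delta) -> \bar R) ->
  (forall w, (0 <= g w)%E) ->
  (\int[P]_w (g w * (\1_[set w | V (X r w, segment X delta r0 w)] w)%:E) =
   \int[P]_w (g w * bridge_section k V (X r w) (X (r + delta)%R w)))%E.
Proof.
move=> mg g0.
have mX u : outside r delta u -> measurable_fun setT (X u).
  by case=> [/andP[u0 _]|ru]; apply: levy_measurable => //;
    apply: le_trans ru; rewrite addr_ge0// ltW.
have mXr : measurable_fun setT (X r) by apply: mX; left; rewrite r0 lexx.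
have mXrd : measurable_fun setT (X (r + delta)) by apply: mX; right.
have mseg := @measurable_segment _ _ _ _ X _ delta r0.
apply: (sub_sigma_integral (G := cyl X (outside r delta))) => //.
- by move=> _ [u /mX mu [A mA ->]]; rewrite -[X in measurable X]setTI; exact: mu.
- apply/measurable_EFinP; apply: measurable_indic.
  by have := measurable_fun_pair mXr mseg measurableT mV; rewrite setTI.
- exact: measurableT_comp (measurable_bridge_section k mV) (measurable_fun_pair mXr mXrd).
- move=> w; rewrite ge0_fin_numE ?bridge_section_ge0//.
  exact: le_lt_trans (bridge_section_le1 _ _) (ltry _).
- by move=> H mH; exact: (bridge_step_set r0 delta0 hk mV mH).
Qed.

End bridge_step_fun.

Section chain.
Context d (T : measurableType d) (R : realType) (P : probability T R).
Variables (X : levy_process P).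
Variable k : forall t : R, R.-pker R ~> cadlag 0 t.
Hypothesis hk : forall t : R, 0 < t -> is_bridge_kernel X (k t).
Variable D : set R.
Hypothesis mD : measurable D.

(* The norm keeps the definition total in [s]; only [0 <= s] matters. The
   duration is [t - 0] because [bridge_law k 0 t] evaluates [k (t - 0)]. *)
Definition levy_segment (s t : R) (w : T) : cadlag 0 t :=
  shift_path (X `|s| w) (segment X (t - 0) (normr_ge0 s) w).

Lemma levy_segmentE s t w u : 0 <= s -> levy_segment s t w u = X (s + clamp 0 t u) w.
Proof.
move=> s0; rewrite /levy_segment /segment /= !subr0 (ger0_norm s0) addrCA subrr.
by rewrite addr0.
Qed.

Lemma measurable_levy_segment s t : 0 <= s -> measurable_fun setT (levy_segment s t).
Proof.
move=> s0; apply: measurable_cadlag => u.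
have : measurable_fun setT (X (s + clamp 0 t u)).
  by apply: levy_measurable; rewrite addr_ge0// clamp_ge0.
by congr measurable_fun; apply/funext => w; rewrite levy_segmentE.
Qed.

Lemma measurable_shift2 (t : R) : measurable_fun setT
  (fun p : R * cadlag 0 (t - 0) => @shift_path R 0 t p.1 p.2).
Proof.
apply: measurable_cadlag => u /=; apply: measurable_funD => //.
exact: (measurableT_comp (@measurable_eval _ 0 (t - 0) (u - 0)) measurable_snd).
Qed.

Variable A : forall s t : R, set (cadlag 0 t).
Arguments A : clear implicits.
Hypothesis mA : forall s t : R, measurable (A s t).

(** At length zero this and [segment_prob] read the position only, in accordance with [exit_prob] at
    duration 0. The set [A] depends on the starting time too, because the sets enclosing the exit
    event depend on the law of the segment. *)
Definition segment_indic (s t : R) (w : T) : R :=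
  if t == 0 then \1_D (X s w) else \1_(A s t) (levy_segment s t w).

Definition segment_prob (s t x y : R) : R :=
  if t == 0 then \1_D x else fine (bridge_law k 0 t x y (A s t)).

Lemma segment_indic01 s t w : 0 <= segment_indic s t w <= 1.
Proof. by rewrite /segment_indic; case: ifP => _; rewrite indicE ler0n lern1 leq_b1. Qed.

Let V (s t : R) := [set p : R * cadlag 0 (t - 0) | A s t (@shift_path R 0 t p.1 p.2)].

Arguments V : clear implicits.

Let mV (s t : R) : measurable (V s t).
Proof. by have := @measurable_shift2 t measurableT _ (@mA s t); rewrite setTI. Qed.

Lemma bridge_lawE (s t x y : R) : bridge_law k 0 t x y (A s t) =
  bridge_section (k (t - 0)) (V s t) x y.
Proof. by []. Qed.

Lemma segment_prob01 s t x y : 0 <= segment_prob s t x y <= 1.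
Proof.
rewrite /segment_prob; case: ifP => _; first by rewrite indicE ler0n lern1 leq_b1.
rewrite bridge_lawE fine_ge0 ?bridge_section_ge0//=.
rewrite -[leRHS]/(fine 1%E) fine_le// ?bridge_section_le1// ge0_fin_numE.
  exact: le_lt_trans (bridge_section_le1 _ _ _ _) (ltry _).
exact: bridge_section_ge0.
Qed.

Lemma segment_prob_fin s t x y : (bridge_law k 0 t x y (A s t)) \is a fin_num.
Proof.
rewrite bridge_lawE ge0_fin_numE ?bridge_section_ge0//.
exact: le_lt_trans (bridge_section_le1 _ _ _ _) (ltry _).
Qed.

Lemma measurable_segment_prob s t :
  measurable_fun setT (fun p : R * R => segment_prob s t p.1 p.2).
Proof.
rewrite /segment_prob; case: (eqVneq t 0) => t0.
  have mI : measurable_fun setT (\1_D : R -> R) by exact: measurable_indic.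
  exact: (measurableT_comp mI measurable_fst).
have mfine : measurable_fun setT (fine : \bar R -> R) by exact: fine_measurable.
exact: (measurableT_comp mfine (measurable_bridge_section (k (t - 0)) (@mV s t))).
Qed.

Lemma measurable_segment_indic (J : set R) s t : 0 <= s -> 0 <= t ->
  (forall u, s <= u <= s + t -> J u) ->
  measurable_fun setT (segment_indic s t : gcyl X J -> R).
Proof.
move=> s0 t0 HJ; rewrite /segment_indic; case: (eqVneq t 0) => tz.
  have mI : measurable_fun setT (\1_D : R -> R) by exact: measurable_indic.
  apply: (measurableT_comp mI).
  by apply: measurable_coord; apply: HJ; rewrite lexx lerDl.
have mI : measurable_fun setT (\1_(A s t) : cadlag 0 t -> R).
  by apply: measurable_indic; exact: mA.
apply: (measurableT_comp mI).
apply: measurable_cadlag => u.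
have : measurable_fun setT (X (s + clamp 0 t u) : gcyl X J -> R).
  apply: measurable_coord; apply: HJ.
  by rewrite lerDl lerD2l clamp_ge0 clamp_le.
by congr measurable_fun; apply/funext => w; rewrite levy_segmentE.
Qed.

Lemma segment_step s t (g : T -> R) : 0 <= s -> 0 <= t ->
  measurable_fun setT (g : gcyl X (outside s t) -> R) -> (forall w, 0 <= g w) ->
  (\int[P]_w (g w * segment_indic s t w)%:E =
   \int[P]_w (g w * segment_prob s t (X s w) (X (s + t)%R w))%:E)%E.
Proof.
move=> s0 t0 mg g0; rewrite /segment_indic /segment_prob.
case: (eqVneq t 0) => // tz.
have tp : 0 < t - 0 by rewrite subr0 lt_def tz.
have := @bridge_step _ _ _ _ X `|s| (t - 0) (normr_ge0 s) tp (k (t - 0)) (hk tp)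
  (V s t) (@mV s t) (EFin \o g).
rewrite [X in outside X _](ger0_norm s0) [X in outside _ X]subr0.
have mEg : measurable_fun setT (EFin \o g : gcyl X (outside s t) -> \bar R).
  exact/measurable_EFinP.
move=> /(_ mEg) H; transitivity (\int[P]_w ((EFin \o g) w * (\1_[set w' |
    V s t (X `|s| w', segment X (t - 0) (normr_ge0 s) w')] w)%:E))%E.
  by apply: eq_integral => w _ /=; rewrite EFinM; congr (_ * _%:E)%E; exact: indic_iff.
rewrite H; last by move=> w; rewrite lee_fin.
apply: eq_integral => w _ /=; rewrite EFinM fineK ?segment_prob_fin//.
have -> : X (`|s| + (t - 0)) w = X (s + t) w by rewrite subr0 (ger0_norm s0).
by rewrite bridge_lawE (ger0_norm s0).
Qed.

Variables (n : nat) (r : nat -> R).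
Hypotheses (r_ge0 : forall i, (i <= n)%N -> 0 <= r i)
  (r_le : forall i, (i < n)%N -> r i <= r i.+1).
Variable C : set T.
Hypothesis mC : measurable (C : set (gcyl (fun i => X (r i)) [set i | (i <= n)%N])).
Variable F : R -> R.
Hypotheses (mF : measurable_fun setT F) (F0 : forall x, 0 <= F x).

Let chi i w := segment_indic (r i) (r i.+1 - r i) w.
Let rho i w := segment_prob (r i) (r i.+1 - r i) (X (r i) w) (X (r i.+1) w).

Lemma chain_segments :
  (\int[P]_(w in C) (F (X (r n) w) * \prod_(i < n) chi i w)%:E =
   \int[P]_(w in C) (F (X (r n) w) * \prod_(i < n) rho i w)%:E)%E.
Proof.
(* A hybrid of the two products: indicators on the segments before [j], probabilities from [j] on.
   Consecutive hybrids differ in one factor, and the remaining factors [g] read whole earlier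
   segments and later endpoints, all outside that segment. *)
pose h j i w := if (i < j)%N then chi i w else rho i w.
pose I j := (\int[P]_w (\1_C w * F (X (r n) w) * \prod_(i < n) h j i w)%:E)%E.
have IE j (p : nat -> T -> R) : (forall i w, (i < n)%N -> p i w = h j i w) ->
    (\int[P]_(w in C) (F (X (r n) w) * \prod_(i < n) p i w)%:E = I j)%E.
  move=> ph; rewrite integral_mkcond; apply: eq_integral => w _.
  rewrite patchE indicE; case: ifP => _; last by rewrite !mul0r.
  by rewrite mul1r; congr (_ * _)%:E; apply: eq_bigr => i _; rewrite ph.
rewrite (IE n chi); last by move=> i w iN; rewrite /h iN.
rewrite (IE 0%N rho)//.
have : forall j, (j <= n)%N -> I j = I 0%N; last exact.
elim=> // j IH jn; rewrite -IH ?(ltnW jn)//.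
have grid := grid_le r_le.
have rj0 : 0 <= r j by apply: r_ge0; exact: ltnW.
have dj0 : 0 <= r j.+1 - r j by rewrite subr_ge0 r_le.
pose J := outside (r j) (r j.+1 - r j).
have Jr i : (i <= n)%N -> J (r i).
  move=> iN; have [ij|ji] := leqP i j.
    by left; rewrite r_ge0// grid// ij ltnW.
  by right; rewrite addrC subrK grid// ji.
have mXr i : (i <= n)%N -> measurable_fun setT (X (r i) : gcyl X J -> R).
  by move=> iN; apply: measurable_coord; exact: Jr.
pose g w := \1_C w * F (X (r n) w) * \prod_(i < n | i != Ordinal jn) h j i w.
have step := @segment_step (r j) (r j.+1 - r j) g rj0 dj0.
have mg : measurable_fun setT (g : gcyl X J -> R).
  apply: measurable_funM; first apply: measurable_funM.
  - apply: measurable_indic; apply: (gcyl_measurable (T := gcyl X J)) mC => i /= iN.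
    exact: mXr.
  - by apply: (measurableT_comp mF); exact: mXr.
  - rewrite /g; under eq_fun do rewrite big_mkcond /=.
    apply: measurable_prod => i _; case: (eqVneq i (Ordinal jn)) => //= ij.
    rewrite /h; case: (ltnP i j) => ltij.
    + apply: measurable_segment_indic.
      * by apply: r_ge0; exact: ltnW.
      * by rewrite subr_ge0 r_le.
      * move=> u /andP[u1 u2]; left; apply/andP; split.
          by apply: le_trans u1; apply: r_ge0; exact: ltnW.
        apply: (le_trans u2); rewrite addrC subrK grid// ltij/= ltnW//.
    + apply: (measurableT_comp (measurable_segment_prob (r i) (r i.+1 - r i))
        (measurable_fun_pair (mXr i (ltnW (ltn_ord i))) (mXr i.+1 (ltn_ord i)))).
have g0 w : 0 <= g w.
  rewrite /g mulr_ge0 ?mulr_ge0//; apply: prodr_ge0 => i _; rewrite /h.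
  by case: ifP => _; [case/andP: (segment_indic01 (r i) (r i.+1 - r i) w)|
    case/andP: (segment_prob01 (r i) (r i.+1 - r i) (X (r i) w) (X (r i.+1) w))].
have rjE : r j + (r j.+1 - r j) = r j.+1 by rewrite addrC subrK.
have step' := step mg g0; rewrite rjE in step'.
transitivity (\int[P]_w (g w * segment_indic (r j) (r j.+1 - r j) w)%:E)%E.
  apply: eq_integral => w _; rewrite (bigD1 (Ordinal jn))//= {1}/h ltnSn.
  rewrite [chi j w * _]mulrC mulrA /g; congr (_ * _ * _)%:E.
  apply: eq_bigr => i ij; rewrite /h ltnS leq_eqVlt.
  by rewrite (_ : (i == j :> nat) = false)//; apply/negbTE.
rewrite step'; apply: eq_integral => w _; rewrite (bigD1 (Ordinal jn))//= {1}/h ltnn.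
by rewrite [rho j w * _]mulrC mulrA.
Qed.

End chain.

(** * Exit from the domain *)

Section exit.
Context d (T : measurableType d) (R : realType) (P : probability T R).
Variables (X : levy_process P) (a b : \bar R).

Lemma open_domain : open (domain a b).
Proof.
rewrite (_ : domain a b = [set x | a < x%:E]%E `&` [set x | x%:E < b]%E)//.
by apply: openI; [exact: open_ereal_gt|exact: open_ereal_lt].
Qed.

Lemma measurable_domain : measurable (domain a b).
Proof. by apply: open_measurable; exact: open_domain. Qed.

Definition exit_set (t : R) : set (cadlag 0 t) :=
  [set c | exists2 u, 0 <= u <= t & (~` domain a b) (path_fun c u)].

(** For a path that stays inside, the infimum is that of the empty set, [+oo]; for any other it is
    at most an exit time in [[0, t]], attained or not. *)
Lemma exit_time_le (t : R) :
  [set c : cadlag 0 t | (exit_time a b `[0%R, t] c <= t%:E)%E] = @exit_set t.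
Proof.
apply/seteqP; split => c /=.
- move=> le; apply: contrapT => nE; move: le; apply/negP; rewrite -ltNge.
  rewrite (_ : exit_time _ _ _ _ = +oo%E) ?ltry// /exit_time.
  rewrite (_ : [set u%:E | u in _] = set0) ?ereal_inf0//.
  rewrite -subset0 => x [u [ut nD] _]; apply: nE; exists u => //.
- move=> [u ut nD]; apply: (@le_trans _ _ u%:E); last by rewrite lee_fin; case/andP: ut.
  by apply: ereal_inf_lbound; exists u => //; split => //=; rewrite in_itv.
Qed.

(** Staying up to time 1 gives the strict inequality because the domain is open and the path
    right-continuous at 1, which keeps it inside a little longer. *)
Lemma exit_time_gt1 w : (1 < exit_time a b `[0%R, +oo[ (X^~ w))%E <->
  forall u, 0 <= u <= 1 -> domain a b (X u w).
Proof.
split=> [lt1 u /andP[u0 u1]|H].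
  apply: contrapT => nD; move: lt1; apply/negP; rewrite -leNgt.
  apply: (@le_trans _ _ u%:E); last by rewrite lee_fin.
  by apply: ereal_inf_lbound; exists u => //; split => //=; rewrite in_itv /= u0.
have D1 : nbhs (X 1 w) (domain a b).
  by apply: open_nbhs_nbhs; split; [exact: open_domain|apply: H; rewrite ler01 lexx].
have := @levy_rcont _ _ _ _ X w 1 ler01 _ D1.
rewrite /nbhs /= /at_right /within /= => -[e e0 eD].
apply: (@lt_le_trans _ _ (1 + e)%:E); first by rewrite lte_fin ltrDl.
apply: le_ereal_inf_tmp => _ [u [/= u0 nD] <-]; rewrite lee_fin leNgt; apply/negP => ue.
have {}u0 : 0 <= u by move: u0; rewrite in_itv /= andbT.
apply: nD; have [u1|u1] := leP u 1; first by apply: H; rewrite u0.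
by apply: (eD u) => //=; rewrite distrC ger0_norm; lra.
Qed.

(** The null gap refers to the law of the segment from time [s], starting value included, so the
    pair is chosen for each [s] and [t]. The trivial pair at negative arguments makes the choice
    total. *)
Lemma exit_set_sandwich (s t : R) : exists LU : set (cadlag 0 t) * set (cadlag 0 t),
  [/\ measurable LU.1, measurable LU.2, LU.1 `<=` @exit_set t, @exit_set t `<=` LU.2 &
   0 <= s -> 0 <= t -> P [set w | (LU.2 `\` LU.1) (levy_segment X s t w)] = 0%E].
Proof.
have [t0|t0] := leP 0 t; last first.
  exists (set0, setT); split => //=; by rewrite leNgt t0.
have [s0|s0] := leP 0 s; last first.
  exists (set0, setT); split => //=; by rewrite leNgt s0.
have mseg := @measurable_levy_segment _ _ _ _ X s t s0.
pose segm : {mfun T >-> cadlag 0 t} := HB.pack_for {mfun T >-> cadlag 0 t}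
  (levy_segment X s t) (isMeasurableFun.Build _ _ _ _ (levy_segment X s t) mseg).
have [] := @hitting_sandwich _ (cadlag 0 t) R (distribution P segm) (~` domain a b) t
  (@eval_cadlag R 0 t) (open_closedC open_domain) t0.
- by move=> u _; exact: measurable_eval.
- by move=> c u ut; exact: path_rcont.
by move=> L [U [mL mU LE EU UL]]; exists (L, U); split.
Qed.

Definition exit_inner (s t : R) : set (cadlag 0 t) := (sval (cid (exit_set_sandwich s t))).1.
Definition exit_outer (s t : R) : set (cadlag 0 t) := (sval (cid (exit_set_sandwich s t))).2.

Arguments exit_inner : clear implicits.
Arguments exit_outer : clear implicits.

Lemma exit_innerP (s t : R) : [/\ measurable (exit_inner s t : set (cadlag 0 t)),
  measurable (exit_outer s t : set (cadlag 0 t)),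
  exit_inner s t `<=` @exit_set t, @exit_set t `<=` exit_outer s t &
   0 <= s -> 0 <= t -> P [set w |
     (exit_outer s t `\` exit_inner s t) (levy_segment X s t w)] = 0%E].
Proof. by rewrite /exit_inner /exit_outer; case: cid. Qed.

Variable k : forall t : R, R.-pker R ~> cadlag 0 t.
Arguments k : clear implicits.

Definition stay_inner (s t : R) : set (cadlag 0 t) := ~` exit_outer s t.
Definition stay_outer (s t : R) : set (cadlag 0 t) := ~` exit_inner s t.
Arguments stay_inner : clear implicits.
Arguments stay_outer : clear implicits.

Lemma measurable_stay_inner (s t : R) : measurable (stay_inner s t).
Proof. by apply: measurableC; have [] := exit_innerP s t. Qed.

Lemma measurable_stay_outer (s t : R) : measurable (stay_outer s t).
Proof. by apply: measurableC; have [] := exit_innerP s t. Qed.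

(** Monotonicity of the outer measure under each single bridge law; no null set intervenes, so the
    bounds hold for all endpoints. *)
Lemma stay_prob_sandwich (s t x y : R) : 0 <= t ->
  segment_prob k (domain a b) stay_inner s t x y <= 1 - exit_prob a b k x y t <=
  segment_prob k (domain a b) stay_outer s t x y.
Proof.
move=> t0; rewrite /segment_prob /exit_prob; case: eqVneq => [_|tz].
  rewrite !indicE in_setC; case: (x \in domain a b) => /=; apply/andP; split; lra.
rewrite [X in mu_ext _ X](_ : _ = @exit_set t); last exact: exit_time_le.
have [mL mU LE EU _] := exit_innerP s t.
have msh := @measurable_shift_path R 0 t x.
pose m : {measure set (cadlag 0 (t - 0)) -> \bar R} := k (t - 0) (y - x).
pose mu_ : {measure set (cadlag 0 t) -> \bar R} := pushforward m (@shift_path R 0 t x).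
pose mu := mu_ msh.
have muE : bridge_law k 0 t x y = mu by [].
have muT : mu setT = 1%E by rewrite /= /pushforward preimage_setT /m prob_kernel.
have muC B : measurable B -> mu (~` B) = (1 - mu B)%E.
  move=> mB; by rewrite -muT -setTD measureD ?setTI//; change (mu setT < +oo)%E; rewrite muT ltry.
have muF B : measurable B -> mu B \is a fin_num.
  move=> mB; rewrite ge0_fin_numE//; apply: (@le_lt_trans _ _ (mu setT)); last by rewrite muT ltry.
  by apply: le_measure; rewrite ?inE.
have lo : (mu (exit_inner s t) <= (mu^*%mu (@exit_set t)))%E.
  by rewrite -(measurable_mu_extE mu mL); exact: le_mu_ext.
have hi : (mu^*%mu (@exit_set t) <= mu (exit_outer s t))%E.
  by rewrite -(measurable_mu_extE mu mU); exact: le_mu_ext.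
rewrite !muE /stay_inner /stay_outer !muC// !fineB ?muF//=.
have mEf : (mu^*%mu (@exit_set t)) \is a fin_num.
  rewrite ge0_fin_numE ?mu_ext_ge0//; apply: (le_lt_trans hi).
  by rewrite -ge0_fin_numE// muF.
by rewrite !lerD2l !lerN2 !fine_le// muF.
Qed.

Lemma exit_prob_le1 (x y t : R) : 0 <= t -> 0 <= 1 - exit_prob a b k x y t.
Proof.
move=> t0; have /andP[+ _] := stay_prob_sandwich 0 x y t0.
apply: le_trans; have := @segment_prob01 _ k (domain a b) stay_inner
  measurable_stay_inner 0 t x y; by case/andP.
Qed.

Lemma stay_indic_outer (s t : R) w : 0 <= s -> 0 <= t ->
  (forall u, s <= u <= s + t -> domain a b (X u w)) ->
  segment_indic X (domain a b) stay_outer s t w = 1.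
Proof.
move=> s0 t0 H; rewrite /segment_indic; case: (eqVneq t 0) => tz.
  by rewrite indicE mem_set//; apply: H; rewrite lexx lerDl.
rewrite indicE mem_set//; have [_ _ LE _ _] := exit_innerP s t.
move=> /LE[u ut]; apply; rewrite levy_segmentE//; apply: H.
by rewrite lerDl lerD2l clamp_ge0 clamp_le.
Qed.

Lemma stay_indic_inner (s t u : R) w : 0 <= s -> s <= u <= s + t ->
  segment_indic X (domain a b) stay_inner s t w != 0 -> domain a b (X u w).
Proof.
move=> s0 sut; rewrite /segment_indic; case: (eqVneq t 0) => tz.
  rewrite indicE pnatr_eq0 eqb0 negbK inE.
  by rewrite (_ : u = s)//; move: sut; rewrite tz addr0 => /le_anti.
rewrite indicE pnatr_eq0 eqb0 negbK inE => nU.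
have [_ _ _ EU _] := exit_innerP s t; apply: contrapT => nD; apply: nU; apply: EU.
have /andP[su ut] := sut; exists (u - s); first by rewrite subr_ge0 su lerBlDl.
rewrite levy_segmentE// /clamp.
rewrite (min_idPl _) ?lerBlDl// (max_idPr _) ?subr_ge0// addrC subrK.
exact: nD.
Qed.

End exit.

Arguments exit_inner {d T R P} X a b s t _.
Arguments exit_outer {d T R P} X a b s t _.
Arguments stay_inner {d T R P} X a b s t _.
Arguments stay_outer {d T R P} X a b s t _.

(** * Lattice times *)

(** A nonnegative integral is a supremum over the simple functions below the integrand, which is
    monotone for arbitrary integrands, the product of exit probabilities among them. *)
Lemma le_integral_nonneg d (T : measurableType d) (R : realType)
    (mu : {measure set T -> \bar R}) (f g : T -> \bar R) :
  (forall w, 0 <= f w)%E -> (forall w, f w <= g w)%E ->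
  (\int[mu]_w f w <= \int[mu]_w g w)%E.
Proof.
move=> f0 fg; have g0 w : (0 <= g w)%E by exact: le_trans (fg w).
rewrite !ge0_integralTE//; apply: ereal_sup_le => _ [h hf <-].
by exists h => // w; exact: le_trans (fg w).
Qed.

Section partition.
Context d (T : measurableType d) (R : realType) (mu : {measure set T -> \bar R}).
Variables (code : T -> nat).
Let part c := code @^-1` [set c].
Hypothesis mpart : forall c, measurable (part c).

Let part_cover : \bigcup_c part c = setT.
Proof. by apply/seteqP; split => // w _; exists (code w). Qed.

Lemma measurable_fun_part d' (U : measurableType d') (f : T -> U) :
  (forall c, measurable_fun (part c) f) -> measurable_fun setT f.
Proof. by move=> mf; rewrite -part_cover; apply/measurable_fun_bigcup. Qed.

Lemma eq_integral_part (f g : T -> \bar R) :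
  (forall w, 0 <= f w)%E -> (forall w, 0 <= g w)%E ->
  (forall c, measurable_fun (part c) f) -> (forall c, measurable_fun (part c) g) ->
  (forall c, \int[mu]_(w in part c) f w = \int[mu]_(w in part c) g w)%E ->
  (\int[mu]_w f w = \int[mu]_w g w)%E.
Proof.
move=> f0 g0 mf mg fg; rewrite -part_cover.
have tp : trivIset setT part by exact: trivIset_preimage1.
rewrite !ge0_integral_bigcup//; last 2 first.
  by rewrite part_cover; exact: measurable_fun_part.
  by rewrite part_cover; exact: measurable_fun_part.
by apply: eq_eseriesr => c _.
Qed.

End partition.

Lemma grid_cover (R : realType) n (r : nat -> R) u : (0 < n)%N -> r 0%N <= u <= r n ->
  exists2 i, (i < n)%N & r i <= u <= r i.+1.
Proof.
elim: n => // n IH _ /andP[r0 rn].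
have [un|nu] := leP u (r n); last by exists n => //; rewrite (ltW nu).
have [n0|n0] := posnP n; first by exists 0%N => //; rewrite r0 -n0.
have [|i iN iu] := IH n0; first by rewrite r0.
by exists i => //; exact: ltnW.
Qed.

Section lattice_times.
Context d (Omega : measurableType d) (R : realType) (P : probability Omega R).
Variables (X : levy_process P) (k : forall t : R, R.-pker R ~> cadlag 0 t).
Arguments k : clear implicits.
Hypothesis hk : forall t : R, 0 < t -> is_bridge_kernel X (k t).
Variable N : Omega -> nat.
Hypotheses (mN : measurable_fun setT N) (N_gt0 : forall w, (0 < N w)%N).
Variable T : nat -> Omega -> R.
Hypotheses (mT : forall i, measurable_fun [set w | (i <= N w)%N] (T i))
  (T_0 : forall w, T 0%N w = 0)
  (T_le : forall w i, (i < N w)%N -> T i w <= T i.+1 w)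
  (T_N : forall w, T (N w) w = 1).
Variable K : set R.
Hypotheses (K_countable : countable K) (T_K : forall w i, (i <= N w)%N -> K (T i w))
  (T_obs : forall n (r : nat -> R), nat_support P N n ->
     (forall i, (i <= n)%N -> K (r i)) -> r 0%N = 0 ->
     (forall i, (i < n)%N -> r i <= r i.+1) -> r n = 1 ->
     sigma_generated n (fun i => X (r i))
       [set w | N w = n /\ forall i, (i <= n)%N -> T i w = r i]).

(** Indexing by an outcome instead of a pair [(n, r)] guarantees an admissible grid. The price is
    that one cell has many indices, hence the numbering below. *)
Definition cell w0 := [set w | N w = N w0 /\ forall i, (i <= N w0)%N -> T i w = T i w0].

Lemma T_ge0 w i : (i <= N w)%N -> 0 <= T i w.
Proof. by move=> iN; rewrite -(T_0 w); apply: (grid_le (@T_le w)). Qed.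

Lemma measurable_le_N i : measurable [set w | (i <= N w)%N].
Proof. by have := mN measurableT (Y := [set n | (i <= n)%N]) I; rewrite setTI. Qed.

Lemma measurable_cell w0 : measurable (cell w0).
Proof.
rewrite (_ : cell w0 = N @^-1` [set N w0] `&` \bigcap_i (if (i <= N w0)%N then
    [set w | (i <= N w)%N] `&` T i @^-1` [set T i w0] else setT)); last first.
  apply/seteqP; split => [w [Nw Tw]|w [/= Nw Tw]].
    split => // i _; case: ifP => // iN; split => /=; first by rewrite Nw.
    exact: Tw.
  by split => // i iN; have := Tw i I; rewrite iN => -[].
apply: measurableI.
  by have := mN measurableT (Y := [set N w0]) I; rewrite setTI.
apply: bigcapT_measurable => i; case: ifP => // _.
by apply: (mT (measurable_le_N i)); exact: measurable_set1.
Qed.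

(** Only the finite sequence of the times up to index [N] counts; its entries lie in the countable
    [K], and finite sequences of naturals are coded by naturals. *)
Lemma cell_code : exists code : Omega -> nat,
  forall w0, code @^-1` [set code w0] = cell w0.
Proof.
have /countable_injP[e einj] := K_countable.
exists (fun w => pickle [seq e (T i w) | i <- iota 0 (N w).+1]) => w0.
apply/seteqP; split => [w wE|w [Nw Tw]].
- have E : [seq e (T i w) | i <- iota 0 (N w).+1] =
      [seq e (T i w0) | i <- iota 0 (N w0).+1] by exact: (pcan_inj pickleK).
  have NE : N w = N w0.
    by have /(congr1 size) := E; rewrite !size_map !size_iota => -[].
  split => // i iN; apply: einj; rewrite ?inE; [apply: T_K; by rewrite NE|exact: T_K|].
  have /(congr1 (fun s => nth 0%N s i)) := E.
  by rewrite !(nth_map 0%N) ?size_iota ?NE// !nth_iota ?NE.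
- suff E : [seq e (T i w) | i <- iota 0 (N w).+1] =
      [seq e (T i w0) | i <- iota 0 (N w0).+1] by rewrite /preimage /mkset E.
  rewrite Nw; apply/eq_in_map => i; rewrite mem_iota => /andP[_ iN].
  by rewrite Tw.
Qed.

Lemma measurable_fun_cells d' (U : measurableType d') (f : Omega -> U) :
  (forall w0, measurable_fun (cell w0) f) -> measurable_fun setT f.
Proof.
have [code cE] := cell_code.
have part c : (exists w0, code @^-1` [set c] = cell w0) \/ code @^-1` [set c] = set0.
  have [[w0 <-]|nc] := pselect (exists w0, code w0 = c); first by left; exists w0.
  by right; rewrite -subset0 => w wc; apply: nc; exists w.
move=> mf; apply: (@measurable_fun_part _ _ code) => c.
  by case: (part c) => [[w0 ->]|->] //; exact: measurable_cell.
by case: (part c) => [[w0 ->]|->] //; exact: measurable_fun_set0.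
Qed.

Lemma eq_integral_cells (f g : Omega -> \bar R) :
  (forall w, 0 <= f w)%E -> (forall w, 0 <= g w)%E ->
  (forall w0, measurable_fun (cell w0) f) -> (forall w0, measurable_fun (cell w0) g) ->
  (forall w0, \int[P]_(w in cell w0) f w = \int[P]_(w in cell w0) g w)%E ->
  (\int[P]_w f w = \int[P]_w g w)%E.
Proof.
have [code cE] := cell_code.
have part c : (exists w0, code @^-1` [set c] = cell w0) \/ code @^-1` [set c] = set0.
  have [[w0 <-]|nc] := pselect (exists w0, code w0 = c); first by left; exists w0.
  by right; rewrite -subset0 => w wc; apply: nc; exists w.
move=> f0 g0 mf mg fg; apply: (@eq_integral_part _ _ _ _ code) => // c.
- by case: (part c) => [[w0 ->]|->] //; exact: measurable_cell.
- by case: (part c) => [[w0 ->]|->] //; exact: measurable_fun_set0.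
- by case: (part c) => [[w0 ->]|->] //; exact: measurable_fun_set0.
- by case: (part c) => [[w0 ->]|->] //; rewrite !integral_set0.
Qed.

Lemma cell_sigma w0 : nat_support P N (N w0) ->
  measurable (cell w0 : set (gcyl (fun i => X (T i w0)) [set i | (i <= N w0)%N])).
Proof.
move=> supp; apply: (T_obs (r := T^~ w0) supp) => //.
- by move=> i iN; exact: T_K.
- by move=> i iN; exact: T_le.
Qed.

(** Observability is assumed for [n] in the support of [N]; the other cells are discarded as
    null. *)
Lemma cell_null w0 : ~ nat_support P N (N w0) -> P (cell w0) = 0%E.
Proof.
move=> /negP; rewrite -leNgt => le0; apply/eqP; rewrite eq_le measure_ge0 andbT.
apply: le_trans le0; apply: le_measure; rewrite ?inE.
- exact: measurable_cell.
- by have := mN measurableT (Y := [set N w0]) I; rewrite setTI.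
- by move=> w [].
Qed.

Section chain_on_cells.
Variable D : set R.
Hypothesis mD : measurable D.
Variable A : forall s t : R, set (cadlag 0 t).
Arguments A : clear implicits.
Hypothesis mA : forall s t : R, measurable (A s t).

Definition path_indic w := \prod_(i < N w)
  segment_indic X D A (T i w) (T i.+1 w - T i w) w.

Definition path_prob w := \prod_(i < N w)
  segment_prob k D A (T i w) (T i.+1 w - T i w) (X (T i w) w) (X (T i.+1 w) w).

Lemma path_indic_ge0 w : 0 <= path_indic w.
Proof.
by apply: prodr_ge0 => i _; case/andP: (segment_indic01 X D A (T i w) (T i.+1 w - T i w) w).
Qed.

Lemma path_prob_ge0 w : 0 <= path_prob w.
Proof.
apply: prodr_ge0 => i _; by case/andP: (segment_prob01 k D mA (T i w)
  (T i.+1 w - T i w) (X (T i w) w) (X (T i.+1 w) w)).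
Qed.

Let cell_indic w0 w := \prod_(i < N w0)
  segment_indic X D A (T i w0) (T i.+1 w0 - T i w0) w.

Let cell_prob w0 w := \prod_(i < N w0)
  segment_prob k D A (T i w0) (T i.+1 w0 - T i w0) (X (T i w0) w) (X (T i.+1 w0) w).

Lemma path_indic_cell w0 w : cell w0 w -> path_indic w = cell_indic w0 w.
Proof.
move=> [Nw Tw]; rewrite /path_indic Nw; apply: eq_bigr => i _.
by rewrite !Tw// ltnW.
Qed.

Lemma path_prob_cell w0 w : cell w0 w -> path_prob w = cell_prob w0 w.
Proof.
move=> [Nw Tw]; rewrite /path_prob Nw; apply: eq_bigr => i _.
by rewrite !Tw// ltnW.
Qed.

Lemma measurable_path_indic w0 : measurable_fun (cell w0) path_indic.
Proof.
apply: (@eq_measurable_fun _ _ _ _ _ (cell_indic w0)).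
  by move=> w /set_mem cw; rewrite (path_indic_cell cw).
apply: measurable_funTS; apply: measurable_prod => i _.
apply: (measurable_sub_sigma (G := cyl X [set u | 0 <= u])).
  by move=> _ [u u0 [B mB ->]]; rewrite -[X in measurable X]setTI; apply: levy_measurable.
apply: measurable_segment_indic => //.
- by apply: T_ge0; exact: ltnW.
- by rewrite subr_ge0 T_le.
- by move=> u /andP[su _] /=; apply: le_trans su; apply: T_ge0; exact: ltnW.
Qed.

Lemma measurable_path_prob w0 : measurable_fun (cell w0) path_prob.
Proof.
apply: (@eq_measurable_fun _ _ _ _ _ (cell_prob w0)).
  by move=> w /set_mem cw; rewrite (path_prob_cell cw).
apply: measurable_funTS; apply: measurable_prod => i _.
have mX j : (j <= N w0)%N -> measurable_fun setT (X (T j w0)).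
  by move=> jN; apply: levy_measurable; exact: T_ge0.
exact: (measurableT_comp (measurable_segment_prob k mD mA (T i w0) (T i.+1 w0 - T i w0))
  (measurable_fun_pair (mX i (ltnW (ltn_ord i))) (mX i.+1 (ltn_ord i)))).
Qed.

Variable F : R -> R.
Hypotheses (mF : measurable_fun setT F) (F0 : forall x, 0 <= F x).

Lemma measurable_FX1 : measurable_fun setT (fun w => F (X 1 w)).
Proof. by apply: (measurableT_comp mF); apply: levy_measurable. Qed.

Lemma path_chain : (\int[P]_w (F (X 1 w) * path_indic w)%:E =
  \int[P]_w (F (X 1 w) * path_prob w)%:E)%E.
Proof.
have mI w0 : measurable_fun (cell w0) (fun w => (F (X 1 w) * path_indic w)%:E).
  apply/measurable_EFinP; apply: measurable_funM; last exact: measurable_path_indic.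
  exact: measurable_funTS measurable_FX1.
have mP w0 : measurable_fun (cell w0) (fun w => (F (X 1 w) * path_prob w)%:E).
  apply/measurable_EFinP; apply: measurable_funM; last exact: measurable_path_prob.
  exact: measurable_funTS measurable_FX1.
apply: eq_integral_cells => //.
- by move=> w; rewrite lee_fin mulr_ge0// path_indic_ge0.
- by move=> w; rewrite lee_fin mulr_ge0// path_prob_ge0.
move=> w0; have [supp|/cell_null null] := pselect (nat_support P N (N w0)); last first.
  by rewrite !null_set_integral//; exact: measurable_cell.
(* The last time of the grid is 1, so [X 1] is one of the grid values. *)
transitivity (\int[P]_(w in cell w0) (F (X (T (N w0) w0) w) * cell_indic w0 w)%:E)%E.
  by apply: eq_integral => w /set_mem cw; rewrite (path_indic_cell cw) T_N.
transitivity (\int[P]_(w in cell w0) (F (X (T (N w0) w0) w) * cell_prob w0 w)%:E)%E.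
  apply: (chain_segments hk mD mA _ _ (cell_sigma supp) mF F0).
  - by move=> i; exact: T_ge0.
  - by move=> i; exact: T_le.
by apply: eq_integral => w /set_mem cw; rewrite (path_prob_cell cw) T_N.
Qed.

End chain_on_cells.

(** * Squeezing the exit identity *)

Section stay.
Variables (a b : \bar R).
Let D := domain a b.
Let Ai := stay_inner X a b.
Let Ao := stay_outer X a b.
Arguments Ai : clear implicits.
Arguments Ao : clear implicits.
Let mD : measurable D := measurable_domain a b.
Let mAi (s t : R) : measurable (Ai s t). Proof. exact: measurable_stay_inner. Qed.
Let mAo (s t : R) : measurable (Ao s t). Proof. exact: measurable_stay_outer. Qed.

Let stays w : R := \1_[set w' | (1 < exit_time a b `[0%R, +oo[ (X^~ w'))%E] w.
Let stay_prob w : R := \prod_(i < N w) (1 - exit_prob a b k (X (T i w) w)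
                (X (T i.+1 w) w) (T i.+1 w - T i w)).

Lemma stays_sandwich w : path_indic D Ai w <= stays w <= path_indic D Ao w.
Proof.
have seg i : (i < N w)%N -> 0 <= T i w /\ 0 <= T i.+1 w - T i w.
  by move=> iN; rewrite subr_ge0 T_le// T_ge0// ltnW.
have seg1 i : (i < N w)%N -> T i.+1 w <= 1.
  by move=> iN; rewrite -(T_N w) (grid_le (@T_le w))// iN leqnn.
rewrite /stays indicE; apply/andP; split.
- case: (boolP (w \in _)) => [_|/negP wS].
    by apply: prodr_ile1 => i _; exact: segment_indic01.
  have [prod0|/prodf_neq0 nz] := eqVneq (path_indic D Ai w) 0; first by rewrite prod0.
  exfalso; apply: wS; rewrite inE /=; apply/exit_time_gt1 => u u01.
  have [|i iN iu] := @grid_cover _ (N w) (T^~ w) u (N_gt0 w); first by rewrite T_0 T_N.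
  have [s0 t0] := seg i iN.
  apply: (stay_indic_inner (s := T i w) (t := T i.+1 w - T i w) s0).
    by rewrite addrC subrK.
  exact: (nz (Ordinal iN)).
- case: (boolP (w \in _)) => [|_]; last exact: path_indic_ge0.
  rewrite inE /= => /exit_time_gt1 H; rewrite /path_indic big1// => i _.
  have [s0 t0] := seg i (ltn_ord i).
  apply: stay_indic_outer => // u /andP[su ut]; apply: H.
  rewrite (le_trans s0 su)/=; apply: (le_trans ut).
  by rewrite addrC subrK seg1.
Qed.

Lemma stay_prob_path w : path_prob D Ai w <= stay_prob w <= path_prob D Ao w.
Proof.
have t0 (i : 'I_(N w)) : 0 <= T i.+1 w - T i w by rewrite subr_ge0 T_le.
apply/andP; split; apply: ler_prod => i _.
  by have /andP[-> _] := stay_prob_sandwich X a b k (T i w) (X (T i w) w)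
    (X (T i.+1 w) w) (t0 i); case/andP: (segment_prob01 k D mAi (T i w)
    (T i.+1 w - T i w) (X (T i w) w) (X (T i.+1 w) w)) => ->.
have /andP[_ ->] := stay_prob_sandwich X a b k (T i w) (X (T i w) w)
    (X (T i.+1 w) w) (t0 i).
by rewrite (exit_prob_le1 X).
Qed.

Variable F : R -> R.
Hypotheses (mF : measurable_fun setT F) (F0 : forall x, 0 <= F x).

(** On a cell the grid is deterministic, so the two products differ only where one of finitely many
    segments falls into its null gap. *)
Lemma path_indic_inner_outer : (\int[P]_w (F (X 1 w) * path_indic D Ai w)%:E =
  \int[P]_w (F (X 1 w) * path_indic D Ao w)%:E)%E.
Proof.
have mI (A : forall s t : R, set (cadlag 0 t)) (mA : forall s t : R, measurable (@A s t)) w0 :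
    measurable_fun (cell w0) (fun w => (F (X 1 w) * path_indic D A w)%:E).
  apply/measurable_EFinP; apply: measurable_funM; last exact: measurable_path_indic.
  exact: measurable_funTS (measurable_FX1 mF).
apply: eq_integral_cells => [w|w|w0|w0|w0]; try exact: mI.
- by rewrite lee_fin mulr_ge0// path_indic_ge0.
- by rewrite lee_fin mulr_ge0// path_indic_ge0.
apply: ae_eq_integral; [exact: measurable_cell|exact: mI|exact: mI|].
pose t_ i := T i.+1 w0 - T i w0.
pose bad i := [set w | (i < N w0)%N /\ (exit_outer X a b (T i w0) (t_ i) `\`
   exit_inner X a b (T i w0) (t_ i)) (levy_segment X (T i w0) (t_ i) w)].
have nbad i : P.-negligible (bad i).
  have [iN|iN] := ltnP i (N w0); last first.
    apply: negligibleS (@negligible_set0 _ _ _ P) => w [].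
    by rewrite ltnNge iN.
  have Ti0 : 0 <= T i w0 by apply: T_ge0; exact: ltnW.
  have [mL mU _ _ null] := exit_innerP X a b (T i w0) (t_ i).
  apply: (@negligibleS _ _ _ P _ _ _ _); last first.
    apply/negligibleP; last by apply: null => //; rewrite subr_ge0 T_le.
    rewrite -[X in measurable X]setTI; apply: measurable_levy_segment => //.
    exact: measurableD.
  by move=> w [].
apply: negligibleS (negligible_bigcup nbad) => w /= /not_implyP[cw neq].
apply: contrapT => nbadw; apply: neq; congr (_ * _)%:E.
rewrite !(path_indic_cell _ _ cw); apply: eq_bigr => -[i iN] _ /=.
rewrite /segment_indic; case: ifP => // _; apply: indic_iff.
have [_ _ LE EU _] := exit_innerP X a b (T i w0) (t_ i).
split=> [nU /LE/EU //|nL Uw]; apply: nbadw; exists i => //.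
Qed.

(** Four integrals agree: those of the inner and outer indicators through the null gaps, and each of
    these with that of its bridge probabilities through the chain. Both sides of the identity lie
    between them. *)
Lemma stay_integral : (\int[P]_w (F (X 1 w) * stays w)%:E =
  \int[P]_w (F (X 1 w) * stay_prob w)%:E)%E.
Proof.
have ci := path_chain mD mAi mF F0; have co := path_chain mD mAo mF F0.
have io := path_indic_inner_outer.
have s1 w := stays_sandwich w; have s2 w := stay_prob_path w.
have mon (f g : Omega -> R) : (forall w, 0 <= f w) -> (forall w, f w <= g w) ->
    (\int[P]_w (F (X 1 w) * f w)%:E <= \int[P]_w (F (X 1 w) * g w)%:E)%E.
  move=> f0 fg; apply: le_integral_nonneg => w; rewrite lee_fin ?mulr_ge0//.
  by rewrite ler_wpM2l.
have stays0 w : 0 <= stays w.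
  by case/andP: (s1 w) => h _; exact: le_trans (path_indic_ge0 _ _ _) h.
have prob0 w : 0 <= stay_prob w.
  by case/andP: (s2 w) => h _; exact: le_trans (path_prob_ge0 D mAi _) h.
apply/eqP; rewrite eq_le; apply/andP; split.
- apply: (@le_trans _ _ (\int[P]_w (F (X 1 w) * path_indic D Ao w)%:E)%E).
    by apply: mon => // w; case/andP: (s1 w).
  rewrite -io ci; apply: mon => [w|w]; first exact: path_prob_ge0.
  by case/andP: (s2 w).
- apply: (@le_trans _ _ (\int[P]_w (F (X 1 w) * path_prob D Ao w)%:E)%E).
    by apply: mon => // w; case/andP: (s2 w).
  rewrite -co -io; apply: mon => [w|w]; first exact: path_indic_ge0.
  by case/andP: (s1 w).
Qed.

End stay.

(** * Conditional law at an intermediate time *)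

Section interpolation.
Variables (t : R) (n : nat).
Hypotheses (t01 : 0 < t < 1) (supp : nat_support P N n).
Variable A : set R.
Hypothesis mA : measurable A.

Let last w := last_before (N w) (T^~ w) t.

Let bridge_prob s u x y := bridge_law k s u x y [set path | A (path_fun path t)].

Let Y w := bridge_prob (T (last w) w) (T (last w).+1 w)
  (X (T (last w) w) w) (X (T (last w).+1 w) w).

(** [t < 1] keeps the maximal index below [N], and maximality puts the next time strictly after [t].
    The segment around [t] thus has positive length, even if times repeat, and its bridge is
    available. *)
Lemma last_beforeP w : [/\ (last w < N w)%N, T (last w) w <= t & t < T (last w).+1 w].
Proof.
have /andP[t0 t1] := t01.
have [i ti lE] : exists2 i : 'I_(N w).+1, T i w <= t & last w = i.
  have := @eq_bigmax_cond 'I_(N w).+1 (fun i => T i w <= t) (fun i => val i).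
  case.
    by apply/card_gt0P; exists ord0; rewrite unfold_in /= T_0 ltW.
  by move=> i ti iE; exists i => //; exact: ti.
have lN : (last w < N w)%N.
  have := ltn_ord i; rewrite lE ltnS leq_eqVlt => /predU1P[iN|//].
  by move: ti; rewrite iN T_N leNgt t1.
split => //; first by rewrite lE.
rewrite ltNge; apply/negP => Tt.
have := @leq_bigmax_cond _ (fun i : 'I_(N w).+1 => T i w <= t) (fun i => val i)
  (Ordinal (lN : ((last w).+1 < (N w).+1)%N)) Tt.
by rewrite -/(last_before (N w) (T^~ w) t) -/(last w) ltnn.
Qed.

Lemma last_cell w0 w : cell w0 w -> last w = last w0.
Proof.
move=> [Nw Tw]; rewrite /last /last_before Nw; apply: eq_bigl => i.
by rewrite Tw// -ltnS.
Qed.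

Lemma bridge_prob_cell w0 w : cell w0 w -> Y w = bridge_prob (T (last w0) w0) (T (last w0).+1 w0)
  (X (T (last w0) w0) w) (X (T (last w0).+1 w0) w).
Proof.
move=> cw; have [lN _ _] := last_beforeP w0.
by rewrite /Y (last_cell cw); case: cw => _ Tw; rewrite !Tw// ltnW.
Qed.

Let V (s u : R) := [set p : R * cadlag 0 (u - s) | A (p.1 + path_fun p.2 (t - s))].
Arguments V : clear implicits.

Lemma measurable_bridge_event (s u : R) : measurable (V s u).
Proof.
have : measurable_fun setT (fun p : R * cadlag 0 (u - s) => p.1 + path_fun p.2 (t - s)).
  apply: measurable_funD => //.
  exact: (measurableT_comp (@measurable_eval _ 0 (u - s) (t - s)) measurable_snd).
by move=> /(_ measurableT A mA); rewrite setTI.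
Qed.

Lemma measurable_bridge_prob s u :
  measurable_fun setT (fun p : R * R => bridge_prob s u p.1 p.2).
Proof. exact: (measurable_bridge_section (k (u - s)) (@measurable_bridge_event s u)). Qed.

Let gen := [set B : set Omega | exists2 i, (i <= n)%N &
  exists2 A : set (R * R), measurable A & B = (fun w => (T i w, X (T i w) w)) @^-1` A].

(** On a cell the times are constants, so the generators trace events of finitely many fixed-time
    values; the sets with such a trace form a sigma-algebra. *)
Lemma sigma_cell_trace w0 (B : set Omega) : N w0 = n -> <<s gen >> B ->
  exists2 B' : set Omega,
    measurable (B' : set (gcyl (fun i => X (T i w0)) [set i | (i <= N w0)%N])) &
    cell w0 `&` B = cell w0 `&` B'.
Proof.
move=> Nn; pose S := gcyl (fun i => X (T i w0)) [set i | (i <= N w0)%N].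
pose tr := [set B : set Omega | exists2 B' : set S, measurable B' &
  cell w0 `&` B = cell w0 `&` B'].
suff : <<s gen >> `<=` tr by apply.
apply: smallest_sub; first split.
- by exists set0 => //; rewrite setI0.
- move=> C [C' mC' CC']; exists (~` C'); first exact: measurableC.
  rewrite setTD; apply/seteqP; split => w [cw nC]; split => // Cw; apply: nC.
    by have : (cell w0 `&` C') w by []; rewrite -CC' => -[].
  by have : (cell w0 `&` C) w by []; rewrite CC' => -[].
- move=> C HC.
  have /choice[C' CP] : forall i, exists B' : set S, measurable B' /\
      cell w0 `&` C i = cell w0 `&` B'.
    by move=> i; have [B' mB' E] := HC i; exists B'.
  exists (\bigcup_i C' i).
    by apply: bigcupT_measurable => i; have [] := CP i.
  by rewrite !setI_bigcupr; apply: eq_bigcupr => i _; have [] := CP i.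
- move=> _ [i iN [D mD ->]].
  exists ((fun w : S => (T i w0, X (T i w0) w)) @^-1` D).
    have : measurable_fun setT (fun w : S => (T i w0, X (T i w0) w)).
      apply: measurable_fun_pair => //.
      by apply: (measurable_coord (f := fun i => X (T i w0))); rewrite /= Nn.
    by move=> /(_ measurableT D mD); rewrite setTI.
  by apply/seteqP; split => w [[Nw Tw] /= Dw]; split => //; move: Dw; rewrite /= Tw// Nn.
Qed.

Lemma cell_bridge_integral w0 (B : set Omega) : N w0 = n ->
  measurable (B : set (gcyl (fun i => X (T i w0)) [set i | (i <= N w0)%N])) ->
  (\int[P]_(w in cell w0 `&` B) Y w =
   \int[P]_(w in cell w0 `&` B) (\1_[set w | A (X t w)] w)%:E)%E.
Proof.
move=> Nn mB; have [lN Tt tT] := last_beforeP w0.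
set s := T (last w0) w0 in Tt *; set u := T (last w0).+1 w0 in tT *.
have s0 : 0 <= s by apply: T_ge0; exact: ltnW.
have us : 0 < u - s by rewrite subr_gt0 (le_lt_trans Tt).
have mcB := measurableI _ _ (cell_sigma (w0 := w0)
  (eq_ind_r (nat_support P N) supp Nn)) mB.
have mH : measurable (cell w0 `&` B : set (gcyl X (outside s (u - s)))).
  apply: (gcyl_measurable (T := gcyl X (outside s (u - s)))) mcB => i /= iN.
  apply: measurable_coord.
  have grid := grid_le (@T_le w0).
  have [il|li] := leqP i (last w0).
    by left; rewrite T_ge0// grid// il ltnW.
  by right; rewrite addrC subrK grid// li.
have := bridge_step_set s0 us (hk us) (@measurable_bridge_event s u) mH.
have suE : s + (u - s) = u by rewrite addrC subrK.
rewrite suE => step.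
transitivity (\int[P]_(w in cell w0 `&` B) bridge_section (k (u - s)) (V s u) (X s w) (X u w))%E.
  by apply: eq_integral => w /set_mem[cw _]; rewrite (bridge_prob_cell cw).
rewrite -step; apply: eq_integral => w _; congr (_%:E); apply: indic_iff.
rewrite /V /= /segment /= /clamp (min_idPl _); last by rewrite lerD2r ltW.
rewrite (max_idPr _) ?subr_ge0//.
have -> : X s w + (X (s + (t - s)) w - X s w) = X t w.
  by rewrite [s + (t - s)]addrC subrK; ring.
by [].
Qed.

Lemma measurable_bridge_prob_cell w0 : measurable_fun (cell w0) Y.
Proof.
have [lN _ _] := last_beforeP w0.
apply: (@eq_measurable_fun _ _ _ _ _ (fun w => bridge_prob (T (last w0) w0)
  (T (last w0).+1 w0) (X (T (last w0) w0) w) (X (T (last w0).+1 w0) w))).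
  by move=> w /set_mem cw; rewrite (bridge_prob_cell cw).
apply: measurable_funTS.
have mX j : (j <= N w0)%N -> measurable_fun setT (X (T j w0)).
  by move=> jN; apply: levy_measurable; exact: T_ge0.
exact: (measurableT_comp (measurable_bridge_prob (T (last w0) w0) (T (last w0).+1 w0))
  (measurable_fun_pair (mX _ (ltnW lN)) (mX _ lN))).
Qed.

Lemma bridge_interpolation :
  is_cond_prob P [set w | N w = n] (sigma_generated n (fun i w => (T i w, X (T i w) w)))
    [set w | A (X t w)] Y.
Proof.
have mC : measurable [set w | N w = n].
  by have := mN measurableT (Y := [set n]) I; rewrite setTI.
have mXt : measurable [set w | A (X t w)].
  have := @levy_measurable _ _ _ _ X t; case/andP: t01 => t0 _ /(_ (ltW t0)).
  by move=> /(_ measurableT A mA); rewrite setTI.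
split.
- move=> S mS; have [code cE] := cell_code.
  pose G : measurableType _ := g_sigma_algebraType gen.
  (* Within [N = n] a cell is cut out by conditions on the [T i], and on it [Y] is a fixed
     measurable function of two observed values; both facts are expressible in [G]. Codes of no such
     cell receive the empty set. *)
  have H c : exists Bc : set G, [/\ measurable Bc,
      forall w, N w = n -> code w = c -> S (Y w) -> Bc w &
      forall w, N w = n -> Bc w -> S (Y w)].
    have [[w0 wc Nw0]|nc] := pselect (exists2 w0, code w0 = c & N w0 = n); last first.
      by exists set0; split => // w Nw wc; case: nc; exists w.
    have [lN _ _] := last_beforeP w0.
    have mTX i : (i <= n)%N -> measurable_fun setT (fun w : G => (T i w, X (T i w) w)).
      move=> iN _ D mD; rewrite setTI; apply: sub_sigma_algebra.
      by exists i => //; exists D.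
    have mTi i : (i <= n)%N -> measurable_fun setT (T i : G -> R).
      by move=> iN; exact: (measurableT_comp measurable_fst (mTX i iN)).
    have mXi i : (i <= n)%N -> measurable_fun setT (fun w : G => X (T i w) w).
      by move=> iN; exact: (measurableT_comp measurable_snd (mTX i iN)).
    pose kap := bridge_prob (T (last w0) w0) (T (last w0).+1 w0).
    exists ((\bigcap_i (if (i <= n)%N then (T i : G -> R) @^-1` [set T i w0] else setT)) `&`
      (fun w : G => kap (X (T (last w0) w) w) (X (T (last w0).+1 w) w)) @^-1` S).
    have cellP w : N w = n -> (forall i, (i <= n)%N -> T i w = T i w0) -> cell w0 w.
      by move=> Nw Tw; split; rewrite Nw0.
    have YE w : cell w0 w -> Y w = kap (X (T (last w0) w) w) (X (T (last w0).+1 w) w).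
      move=> cw; rewrite (bridge_prob_cell cw) /kap; case: cw => _ Tw.
      by rewrite !Tw// ltnW.
    split.
    + apply: measurableI.
        apply: bigcapT_measurable => i; case: ifP => // iN.
        by rewrite -[X in measurable X]setTI; apply: mTi.
      have : measurable_fun setT (fun w : G => kap (X (T (last w0) w) w) (X (T (last w0).+1 w) w)).
        have h1 : (last w0 <= n)%N by rewrite -Nw0 ltnW.
        have h2 : ((last w0).+1 <= n)%N by rewrite -Nw0.
        exact: (measurableT_comp (measurable_bridge_prob _ _)
          (measurable_fun_pair (mXi _ h1) (mXi _ h2))).
      by move=> /(_ measurableT S mS); rewrite setTI.
    + move=> w Nw cw SY; have cw0 : cell w0 w by rewrite -cE /= cw wc.
      split; last by rewrite /= -YE.
      by move=> i _; case: ifP => // iN; case: cw0 => _; apply; rewrite Nw0.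
    + move=> w Nw [Tw]; rewrite /= YE//; apply: cellP => // i iN.
      by have := Tw i I; rewrite iN.
  have [Bc BP] := choice H.
  exists (\bigcup_c Bc c).
    by apply: (@bigcupT_measurable _ G) => c; have [] := BP c.
  apply/seteqP; split => w [/= Nw].
    by move=> SY; split => //; exists (code w) => //; have [_ + _] := BP (code w); exact.
  by move=> [c _ Bw]; split => //; have [_ _] := BP c; exact.
- move=> B GB.
  set C := [set w | N w = n].
  have Y0 w : (0 <= Y w)%E by rewrite /Y /bridge_prob /bridge_law /pushforward measure_ge0.
  have cellC w0 : N w0 = n -> cell w0 `<=` C by move=> Nw0 w [Nw _]; rewrite /C /= Nw.
  have cellNC w0 : N w0 <> n -> forall w, cell w0 w -> ~ C w.
    by move=> Nw0 w [Nw _]; rewrite /C /= Nw.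
  have mcB w0 : N w0 = n -> measurable (cell w0 `&` B).
    move=> Nw0; have [B' mB' ->] := sigma_cell_trace Nw0 GB.
    apply: measurableI; first exact: measurable_cell.
    apply: gcyl_measurable mB' => i /= iN; apply: levy_measurable.
    exact: T_ge0.
  (* [B] alone need not be an event, as [T i] is measurable only where [i <= N]; its trace on [C] is
     one because it is so on each cell. *)
  have mCB : measurable (C `&` B).
    have : measurable_fun setT (\1_(C `&` B) : Omega -> R).
      apply: measurable_fun_cells => w0.
      have [Nw0|Nw0] := eqVneq (N w0) n.
        apply: (@eq_measurable_fun _ _ _ _ _ (\1_(cell w0 `&` B) : Omega -> R)).
          move=> w /set_mem cw; apply: indic_iff; rewrite /setI /=.
          by split => -[_ Bw]; split => //; exact: cellC cw.
        by apply: measurable_indic; exact: mcB.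
      apply: (@eq_measurable_fun _ _ _ _ _ (cst 0 : Omega -> R)).
        move=> w /set_mem cw; rewrite indicE memNset//= => -[Cw _].
        exact: (cellNC w0 (elimN eqP Nw0) w cw).
      exact: measurable_cst.
    move=> /(_ measurableT [set 1] (measurable_set1 1)); rewrite setTI.
    congr measurable; apply/seteqP; split => w /=; rewrite indicE.
      by case: (boolP (w \in _)) => [/set_mem//|_ /eqP]; rewrite eq_sym oner_eq0.
    by move=> ?; rewrite mem_set.
  transitivity (\int[P]_w (\1_([set w | A (X t w)] `&` (C `&` B)) w)%:E)%E; last first.
    by rewrite integral_indic ?setIT//; exact: measurableI.
  rewrite integral_mkcond.
  apply: eq_integral_cells.
  + by move=> w; rewrite patchE; case: ifP.
  + by move=> w; rewrite lee_fin.
  + move=> w0; apply/(measurable_restrict Y mCB (measurable_cell w0)).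
    apply: (measurable_funS (measurable_cell w0) _ (@measurable_bridge_prob_cell w0)).
    by move=> w [].
  + move=> w0; apply: measurable_funTS; apply/measurable_EFinP; apply: measurable_indic.
    exact: measurableI.
  + move=> w0; rewrite -integral_mkcondr.
    have [Nw0|Nw0] := eqVneq (N w0) n; last first.
      rewrite !integral0_eq// => w cw; last first.
        by have := cellNC w0 (elimN eqP Nw0) w cw.1; case: cw => _ [].
      by rewrite indicE memNset// => -[_ [Cw _]]; exact: (cellNC w0 (elimN eqP Nw0) w cw).
    have -> : cell w0 `&` (C `&` B) = cell w0 `&` B.
      by apply/seteqP; split => w [cw]; [case|] => *; split => //; split => //; exact: cellC cw.
    have [B' mB' BB'] := sigma_cell_trace Nw0 GB.
    rewrite BB' cell_bridge_integral// -BB' [LHS]integral_mkcondr.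
    apply: eq_integral => w /set_mem cw; rewrite patchE; case: ifPn => [|/negP] Bw.
      congr (_%:E); apply: indic_iff; rewrite /setI /=.
      by split => [Aw|[]//]; split => //; split; [exact: cellC cw|exact: set_mem].
    by rewrite indicE memNset// => -[_ [_ Bw']]; apply: Bw; exact: mem_set.
Qed.

End interpolation.

End lattice_times.

Unset Implicit Arguments.
Set Strict Implicit.

Theorem lemma4p1 (R : realType) (d : measure_display) (Omega : measurableType d)
  (P : probability Omega R) (X : levy_process P)
  (nu : {measure set R -> \bar R}) (hnu : is_levy_measure X nu)
  (s : R -> R) (hs : regular_levy_density nu s)
  (f : R -> R -> R) (hf : is_transition_density X f)
  (hf_pos : forall t x : R, 0 < t -> 0 < f t x)
  (a b : \bar R) (ha : (a < 0)%E) (hb : (0 < b)%E)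
  (k : forall t : R, R.-pker R ~> cadlag 0 t)
  (hk : forall t : R, 0 < t -> is_bridge_kernel X (k t))
  (N : Omega -> nat) (mN : measurable_fun setT N)
  (N_gt0 : forall w, (0 < N w)%N)
  (T : nat -> Omega -> R)
  (mT : forall i, measurable_fun [set w | (i <= N w)%N] (T i))
  (T_0 : forall w, T 0%N w = 0)
  (T_le : forall w i, (i < N w)%N -> T i w <= T i.+1 w)
  (T_N : forall w, T (N w) w = 1)
  (K : set R) (K_sub : K `<=` `[0, 1]) (K_countable : countable K)
  (T_K : forall w i, (i <= N w)%N -> K (T i w))
  (T_obs : forall n (r : nat -> R), nat_support P N n ->
     (forall i, (i <= n)%N -> K (r i)) -> r 0%N = 0 ->
     (forall i, (i < n)%N -> r i <= r i.+1) -> r n = 1 ->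
     sigma_generated n (fun i => X (r i))
       [set w | N w = n /\ forall i, (i <= n)%N -> T i w = r i]) :
  (forall F : R -> R, measurable_fun setT F ->
     P.-integrable setT (fun w => (F (X 1 w))%:E) ->
     ('E_P[(fun w => F (X 1 w) *
              \1_[set w' | (1 < exit_time a b `[0%R, +oo[ (X^~ w'))%E] w)%R] =
      'E_P[(fun w => F (X 1 w) *
              \prod_(i < N w) (1 - exit_prob a b k (X (T i w) w)
                (X (T i.+1 w) w) (T i.+1 w - T i w)))%R])%E) /\
  (forall (t : R) (n : nat) (A : set R),
     0 < t < 1 -> nat_support P N n -> measurable A ->
     is_cond_prob P [set w | N w = n]
       (sigma_generated n (fun i w => (T i w, X (T i w) w)))
       [set w | A (X t w)]
       (fun w => let i := last_before (N w) (T^~ w) t in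
          bridge_law k (T i w) (T i.+1 w) (X (T i w) w) (X (T i.+1 w) w)
            [set path | A (path_fun path t)])).
Proof.
split=> [F mF _|t n A t01 supp mA]; last exact: bridge_interpolation T_K T_obs _ _ t01 supp _ mA.
(* Both integrands are [F (X 1 w)] times a nonnegative factor, so their positive and negative parts
   are those of [F] times the same factor, and the nonnegative case applies to each. *)
pose Fp x := Num.max (F x) 0; pose Fn x := Num.max (- F x) 0.
have mFp : measurable_fun setT Fp by apply: measurable_maxr.
have mFn : measurable_fun setT Fn by apply: measurable_maxr => //; exact: measurableT_comp.
have Fp0 x : 0 <= Fp x by rewrite le_max lexx orbT.
have Fn0 x : 0 <= Fn x by rewrite le_max lexx orbT.
have pos (c : Omega -> R) : (forall w, 0 <= c w) ->
    (fun w => (F (X 1 w) * c w)%:E)^\+%E = (fun w => (Fp (X 1 w) * c w)%:E).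
  move=> c0; apply/funext => w; rewrite funeposE /Fp maxr_pMl// mul0r.
  by rewrite EFin_max.
have neg (c : Omega -> R) : (forall w, 0 <= c w) ->
    (fun w => (F (X 1 w) * c w)%:E)^\-%E = (fun w => (Fn (X 1 w) * c w)%:E).
  move=> c0; apply/funext => w; rewrite funenegE /Fn maxr_pMl// mul0r mulNr.
  by rewrite EFin_max.
have prob0 w : 0 <= \prod_(i < N w) (1 - exit_prob a b k (X (T i w) w)
    (X (T i.+1 w) w) (T i.+1 w - T i w)).
  by apply: prodr_ge0 => i _; rewrite (exit_prob_le1 X)// subr_ge0 T_le.
rewrite unlock integralE [RHS]integralE !pos// !neg//.
by rewrite !(stay_integral hk mN N_gt0 mT T_0 T_le T_N K_countable T_K T_obs).
Qed.
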